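(* Let $G$ be a group acting cocompactly by automorphisms on a locally finite thick Euclidean building $X$. Let $(W,S)$ be the associated finite Coxeter system of $X$, and let $I \subsetneq S$ (possibly $I=\emptyset$). Then $G$ contains a strongly $I$-regular hyperbolic element.
   Context: Buildings are irreducible, of dimension $\geq 1$, and endowed with their complete system of apartments. The visual boundary $\partial_\infty X$ is a spherical building whose apartments are the boundaries $\partial_\infty \mathcal{B}$ of the apartments $\mathcal{B}$ of $X$; $(W,S)$ is its finite irreducible Coxeter system. Simplices are taken open (without their proper faces). Types: fix a model chamber $c_+$ of $\partial_\infty X$ and identify $S$ with the set of walls through the panels of $c_+$. A face $\sigma$ of $c_+$ has type $I_\sigma$, the set of walls in $S$ containing $\sigma$ (so $I_{c_+}=\emptyset$); an arbitrary simplex of $\partial_\infty X$ has the type of the corresponding face of the model chamber. The phrase ''two opposite ideal simplices of type $I$'' is meant with respect to the walls of the affine building: two opposite simplices lie in exactly the same walls of any ideal apartment containing both, and one of the two has type $I$ in the sense that the face of the model chamber $c_+$ corresponding to it is contained in exactly those walls of $S$ that belong to $I$ (the other one may have a different type with respect to $(W,S)$). For a hyperbolic automorphism $\gamma$ of $X$, $|\gamma|=\inf_{x\in X} d(x,\gamma(x))>0$ and $\mathrm{Min}(\gamma)=\{x\in X : d(x,\gamma(x))=|\gamma|\}$, which is the union of the translation axes of $\gamma$. With $n=\dim X$, $\gamma$ is called $I$-regular hyperbolic if $\mathrm{Min}(\gamma)$ contains a flat of dimension $n-|I|$; it is called strongly $I$-regular hyperbolic if moreover the two endpoints of some (hence every)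 translation axis of $\gamma$ lie, respectively, in the interior of two opposite ideal simplices of type $I$ of $\partial_\infty X$. An element of $G$ is called strongly $I$-regular hyperbolic if it acts on $X$ as such an automorphism. *)

(* Defs.v *)
From HB Require Import structures.
From mathcomp Require Import all_boot all_order all_algebra.
From mathcomp Require Import finmap.
From mathcomp Require Import all_classical all_reals all_analysis.

Set Implicit Arguments.
Unset Strict Implicit.
Unset Printing Implicit Defensive.

Import Order.TTheory GRing.Theory Num.Theory.
Local Open Scope classical_set_scope.
Local Open Scope ring_scope.

(* The library norm on 'rV[R]_n is the sup norm; R^n is Euclidean here. *)
Definition dot (R : realType) (n : nat) (u v : 'rV[R]_n) : R :=
  \sum_(i < n) u 0 i * v 0 i.

Definition enorm (R : realType) (n : nat) (u : 'rV[R]_n) : R :=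
  Num.sqrt (dot u u).

Definition hyperplane (R : realType) (n : nat) (a : 'rV[R]_n) (c : R) :
    set 'rV[R]_n :=
  [set x | dot a x = c].

Definition reflection (R : realType) (n : nat) (a : 'rV[R]_n) (c : R)
    (x : 'rV[R]_n) : 'rV[R]_n :=
  x - (2 * (dot a x - c) / dot a a) *: a.

(* [H] is the set of walls of an irreducible Euclidean (i.e. infinite affine)
   reflection group acting essentially on R^n. *)
Record euclidean_walls (R : realType) (n : nat) (H : set (set 'rV[R]_n)) :
    Prop := {
  walls_hyperplane : forall h, H h ->
    exists a c, a != 0 /\ h = hyperplane a c;
  walls_reflection : forall a c h, H (hyperplane a c) -> H h ->
    H (reflection a c @` h);
  walls_locally_finite : forall (x : 'rV[R]_n) (r : R),
    finite_set [set h | H h /\ exists2 y, h y & enorm (y - x) <= r];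
  walls_infinite : infinite_set H;
  walls_essential : forall v : 'rV[R]_n,
    (forall a c, H (hyperplane a c) -> dot a v = 0) -> v = 0;
  walls_irreducible : forall P : set (set 'rV[R]_n), P `<=` H ->
    (forall a c b e, P (hyperplane a c) -> (H `\` P) (hyperplane b e) ->
      dot a b = 0) ->
    P = set0 \/ P = H
}.

Inductive reflection_group (R : realType) (n : nat) (H : set (set 'rV[R]_n)) :
    ('rV[R]_n -> 'rV[R]_n) -> Prop :=
| reflection_group_id : reflection_group H id
| reflection_group_comp a c w : H (hyperplane a c) ->
    reflection_group H w -> reflection_group H (reflection a c \o w).

(* The linear parts of the walls: the walls of the finite reflection group W,
   whose complex of open cones is the cone over the spherical Coxeter complex
   of (W,S). *)
Definition linear_walls (R : realType) (n : nat) (H : set (set 'rV[R]_n)) :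
    set (set 'rV[R]_n) :=
  [set h | exists a c, H (hyperplane a c) /\ h = hyperplane a 0].

(* The open simplex (open cone, if H is linear) containing u. *)
Definition face (R : realType) (n : nat) (H : set (set 'rV[R]_n))
    (u : 'rV[R]_n) : set 'rV[R]_n :=
  [set z | forall a c, H (hyperplane a c) ->
     Num.sg (dot a z - c) = Num.sg (dot a u - c)].

(* [face H u] is a face of [face H v]: each sign of u is 0 or the sign of v. *)
Definition face_le (R : realType) (n : nat) (H : set (set 'rV[R]_n))
    (u v : 'rV[R]_n) : Prop :=
  forall a c, H (hyperplane a c) ->
    dot a u = c \/ Num.sg (dot a u - c) = Num.sg (dot a v - c).

Definition in_chamber (R : realType) (n : nat) (H : set (set 'rV[R]_n))
    (u : 'rV[R]_n) : Prop :=
  forall h, H h -> ~ h u.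

Definition in_panel_of (R : realType) (n : nat) (H : set (set 'rV[R]_n))
    (u : 'rV[R]_n) (h : set 'rV[R]_n) : Prop :=
  [set k | H k /\ k u] = [set h].

(* The walls through the panels of the chamber containing p. *)
Definition chamber_walls (R : realType) (n : nat) (H : set (set 'rV[R]_n))
    (p : 'rV[R]_n) : set (set 'rV[R]_n) :=
  [set h | exists u, face_le H u p /\ in_panel_of H u h].

Section Building.
Context {R : realType} {n : nat} (H : set (set 'rV[R]_n)).
Context {X : metricType R}.
Implicit Types A : set ('rV[R]_n -> X).

(* X is the geometric realization; A is a set of charts R^n -> X whose images
   are the apartments.  Coordinate changes are restrictions of elements of the
   affine reflection group, so that charts induce a well-defined type function
   on the simplices of X and of its boundary.  In [atlas_change], the
   isomorphism between two apartments fixes pointwise the two simplices that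
   contain f u and f v. *)
Record building_atlas A : Prop := {
  atlas_nonempty : A !=set0;
  atlas_isometric : forall f, A f ->
    forall u v, mdist (f u) (f v) = enorm (u - v);
  atlas_comp : forall f w, A f -> reflection_group H w -> A (f \o w);
  atlas_pair : forall x y : X, exists f, [/\ A f, range f x & range f y];
  atlas_change : forall f g u v, A f -> A g ->
    range g (f u) -> range g (f v) ->
    exists w, reflection_group H w /\
      forall z, face H u z \/ face H v z -> g (w z) = f z
}.

Definition apartments A : set (set X) := [set range f | f in A].

Definition simplices A : set (set X) :=
  [set s | exists f u, A f /\ s = f @` face H u].

Definition chambers A : set (set X) :=
  [set s | exists f u, [/\ A f, in_chamber H u & s = f @` face H u]].

Definition panels A : set (set X) :=
  [set s | exists f u h, [/\ A f, in_panel_of H u h & s = f @` face H u]].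

Definition simplex_le A (s t : set X) : Prop :=
  exists f u v, [/\ A f, face_le H u v, s = f @` face H u & t = f @` face H v].

(* The apartments are those of the complete (i.e. largest) apartment system of
   the simplicial complex X. *)
Definition complete_atlas A : Prop :=
  forall A', building_atlas A' -> simplices A' = simplices A ->
    apartments A' `<=` apartments A.

Definition thick A : Prop :=
  forall s, panels A s -> exists c1 c2 c3,
    [/\ chambers A c1, chambers A c2 & chambers A c3] /\
    [/\ simplex_le A s c1, simplex_le A s c2 & simplex_le A s c3] /\
    [/\ c1 <> c2, c1 <> c3 & c2 <> c3].

Definition locally_finite A : Prop :=
  forall s, simplices A s -> finite_set [set t | simplex_le A s t].

Record euclidean_building A : Prop := {
  building_walls : euclidean_walls H;
  building_is_atlas : building_atlas A;
  building_complete : complete_atlas A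
}.

Record automorphism A (g : X -> X) : Prop := {
  automorphism_bij : bijective g;
  automorphism_isometric : forall x y, mdist (g x) (g y) = mdist x y;
  automorphism_simplicial : forall s, simplices A s -> simplices A (g @` s)
}.

Record acts_by_automorphisms (G : groupType) A (act : G -> X -> X) : Prop := {
  act_one : forall x, act 1%g x = x;
  act_mul : forall g h x, act (g * h)%g x = act g (act h x);
  act_automorphism : forall g, automorphism A (act g)
}.

Definition cocompact (G : groupType) (act : G -> X -> X) : Prop :=
  exists K : set X, compact K /\ forall x, exists g y, K y /\ x = act g y.

Definition geodesic_ray (r : R -> X) : Prop :=
  forall s t, 0 <= s -> 0 <= t -> mdist (r s) (r t) = `|s - t|.

Definition geodesic_line (l : R -> X) : Prop :=
  forall s t, mdist (l s) (l t) = `|s - t|.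

Definition asymptotic (r r' : R -> X) : Prop :=
  exists C, forall t, 0 <= t -> mdist (r t) (r' t) <= C.

(* A point of the visual boundary is a class of asymptotic rays. *)
Definition endpoint (r : R -> X) : set (R -> X) :=
  [set r' | geodesic_ray r' /\ asymptotic r r'].

(* The open simplex, in the boundary of the apartment of f, of the directions
   lying in the open cone containing v; it is a nonempty simplex if v != 0. *)
Definition ideal_face (f : 'rV[R]_n -> X) (v : 'rV[R]_n) :
    set (set (R -> X)) :=
  [set xi | exists u z, [/\ face (linear_walls H) v z, enorm z = 1 &
     xi = endpoint (fun t => f (u + t *: z))]].

Definition opposite_ideal_simplices A (s s' : set (set (R -> X))) : Prop :=
  exists f v, [/\ A f, v != 0, s = ideal_face f v & s' = ideal_face f (- v)].

(* The model chamber is the one containing p.  Charts are type-preserving, so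
   s corresponds to the face of the model chamber containing v; its type is the
   set of walls of the model chamber containing that face. *)
Definition ideal_simplex_of_type A (p : 'rV[R]_n) (I : set (set 'rV[R]_n))
    (s : set (set (R -> X))) : Prop :=
  exists f v, [/\ A f, v != 0, face_le (linear_walls H) v p,
    s = ideal_face f v &
    I = [set h | chamber_walls (linear_walls H) p h /\ h v]].

Definition translation_length (g : X -> X) : R :=
  inf [set mdist x (g x) | x in setT].

Definition min_set (g : X -> X) : set X :=
  [set x | mdist x (g x) = translation_length g].

Definition hyperbolic (g : X -> X) : Prop :=
  0 < translation_length g /\ min_set g !=set0.

Definition translation_axis (g : X -> X) (l : R -> X) : Prop :=
  geodesic_line l /\ forall t, g (l t) = l (t + translation_length g).

Definition flat (k : nat) (F : set X) : Prop :=
  exists phi : 'rV[R]_k -> X,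
    (forall u v, mdist (phi u) (phi v) = enorm (u - v)) /\ F = range phi.

Definition regular_hyperbolic (I : set (set 'rV[R]_n)) (g : X -> X) : Prop :=
  hyperbolic g /\
  exists F, flat (n - #|` fset_set I|) F /\ F `<=` min_set g.

Definition strongly_regular_hyperbolic A (p : 'rV[R]_n)
    (I : set (set 'rV[R]_n)) (g : X -> X) : Prop :=
  regular_hyperbolic I g /\
  exists l s s', [/\ translation_axis g l,
    opposite_ideal_simplices A s s',
    ideal_simplex_of_type A p I s \/ ideal_simplex_of_type A p I s',
    s (endpoint l) & s' (endpoint (fun t => l (- t)))].

End Building.

(* Main.v *)
(* X is CAT(0) by retraction onto apartments, so local geodesics are geodesics. By cocompactness
   and local finiteness G has finitely many orbits of chambers, which bounds the number of walls
   through a point and so makes the set of wall directions finite. Choose u in the open face of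
   type I of the linear chamber of p. Among the chambers near f(0), f(u), f(2u), ... two are
   identified by some g in G, with almost no rotation; since the isometries of R^n that permute the
   walls form a discrete group, g f(z) = f(z + T) for z in a chamber, with T in the face of u.
   The segments [f(z), f(z + T)] are then permuted into geodesic lines, which are axes of g of
   direction T. Charts containing longer and longer pieces of these axes have a limit F, which is a
   chart because the apartment system is complete. The set where g F and F(. + T) agree is a closed
   convex union of faces containing an axis, so it contains its translates by all vectors in the
   intersection of the walls of I; this gives the flat of dimension n - |I| in Min(g). *)

(* Recurrence is sought for open chambers and not for points, since an isometry of R^n is determined
   by its values on an open set. Hence two charts that share a chamber agree on the whole face of
   any point where they agree. This rigidity makes the retractions well defined, leaves finitely
   many possible values at each point when the limit [F] is formed, and makes the set where [g F]
   and [F(. + T)] agree a union of faces. The direction of [T] is known only approximately, but the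
   type of an ideal simplex depends only on the signs of the wall normals. Nonzero signs survive a
   small error. Zero signs do not, and these are the ones that matter when [I] is nonempty: there
   discreteness of the walls has to force exact vanishing. The chart [f] that recurs need not
   contain an axis beyond one period: [g f] and [f(. + T)] are only known to agree on one chamber.
   This is why [f] must be replaced by a chart [F] that contains whole axes before a flat can be
   found. *)
Require Import Defs.
From HB Require Import structures.
From mathcomp Require Import all_boot all_order all_algebra.
From mathcomp Require Import all_classical all_reals all_analysis.
From mathcomp Require Import ring lra.

Set Implicit Arguments.
Unset Strict Implicit.
Unset Printing Implicit Defensive.

Import Order.TTheory GRing.Theory Num.Theory.
Local Open Scope classical_set_scope.
Local Open Scope ring_scope.

(** * Euclidean geometry *)

Section Euclid.
Context {R : realType} {n : nat}.
Implicit Types (x y z u v a b : 'rV[R]_n).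

Lemma dotE x y : dot x y = (x *m y^T) 0 0.
Proof. by rewrite mxE; apply: eq_bigr => i _; rewrite mxE. Qed.

Lemma dotC x y : dot x y = dot y x.
Proof. by apply: eq_bigr => i _; rewrite mulrC. Qed.

Lemma dotDl x y z : dot (x + y) z = dot x z + dot y z.
Proof. by rewrite !dotE mulmxDl mxE. Qed.

Lemma dotDr x y z : dot z (x + y) = dot z x + dot z y.
Proof. by rewrite dotC dotDl !(dotC z). Qed.

Lemma dotZl (k : R) x y : dot (k *: x) y = k * dot x y.
Proof. by rewrite !dotE -scalemxAl mxE. Qed.

Lemma dotZr (k : R) x y : dot x (k *: y) = k * dot x y.
Proof. by rewrite dotC dotZl dotC. Qed.

Lemma dotNl x y : dot (- x) y = - dot x y.
Proof. by rewrite -scaleN1r dotZl mulN1r. Qed.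

Lemma dotNr x y : dot x (- y) = - dot x y.
Proof. by rewrite dotC dotNl dotC. Qed.

Lemma dot0l x : dot 0 x = 0.
Proof. by rewrite dotE mul0mx mxE. Qed.

Lemma dot0r x : dot x 0 = 0.
Proof. by rewrite dotC dot0l. Qed.

Lemma dotMl (Q : 'M[R]_n) x y : dot (x *m Q) y = dot x (y *m Q^T).
Proof. by rewrite !dotE trmx_mul trmxK mulmxA. Qed.

Definition dot_linear := (dotDl, dotDr, dotNl, dotNr, dotZl, dotZr, dot0l, dot0r).

Lemma dotxx_ge0 x : 0 <= dot x x.
Proof. by apply: sumr_ge0 => i _; rewrite -expr2 sqr_ge0. Qed.

Lemma dotxx_eq0 x : (dot x x == 0) = (x == 0).
Proof.
apply/idP/eqP => [|->]; last by rewrite dot0l.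
rewrite psumr_eq0 => [/allP h|i _]; last by rewrite -expr2 sqr_ge0.
apply/rowP => i; have := h i (mem_index_enum _).
by rewrite -expr2 sqrf_eq0 mxE => /eqP.
Qed.

Lemma dotxx_gt0 x : (0 < dot x x) = (x != 0).
Proof. by rewrite lt_def dotxx_ge0 andbT dotxx_eq0. Qed.

Lemma sqr_enorm x : enorm x ^+ 2 = dot x x.
Proof. by rewrite sqr_sqrtr ?dotxx_ge0. Qed.

Lemma enorm_ge0 x : 0 <= enorm x.
Proof. exact: sqrtr_ge0. Qed.

Lemma enorm_eq0 x : (enorm x == 0) = (x == 0).
Proof. by rewrite -dotxx_eq0 -sqr_enorm sqrf_eq0. Qed.

Lemma enorm_gt0 x : (0 < enorm x) = (x != 0).
Proof. by rewrite lt_def enorm_ge0 andbT enorm_eq0. Qed.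

Lemma enorm0 : enorm (0 : 'rV[R]_n) = 0.
Proof. by apply/eqP; rewrite enorm_eq0. Qed.

Lemma enormZ (k : R) x : enorm (k *: x) = `|k| * enorm x.
Proof. by rewrite /enorm dotZl dotZr mulrA -expr2 sqrtrM ?sqr_ge0// sqrtr_sqr. Qed.

Lemma enormN x : enorm (- x) = enorm x.
Proof. by rewrite /enorm dotNl dotNr opprK. Qed.

Lemma enormC x y : enorm (x - y) = enorm (y - x).
Proof. by rewrite -enormN opprB. Qed.

Lemma dot_le x y : dot x y <= enorm x * enorm y.
Proof.
have [->|x0] := eqVneq x 0; first by rewrite dot0l enorm0 mul0r.
have px : 0 < enorm x by rewrite enorm_gt0.
have := dotxx_ge0 (dot x x *: y - dot x y *: x).
have -> : dot (dot x x *: y - dot x y *: x) (dot x x *: y - dot x y *: x) =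
  dot x x * (dot x x * dot y y - dot x y ^+ 2).
  by rewrite !dot_linear (dotC y x); ring.
rewrite pmulr_rge0 ?dotxx_gt0// subr_ge0 -!sqr_enorm -exprMn => h.
have [h0|h0] := lerP (dot x y) 0.
  by apply: le_trans h0 _; rewrite mulr_ge0 ?enorm_ge0.
by rewrite -(ler_pXn2r (n:=2))// nnegrE ?(ltW h0)// mulr_ge0 ?enorm_ge0.
Qed.

Lemma norm_dot_le x y : `|dot x y| <= enorm x * enorm y.
Proof.
rewrite ler_norml dot_le andbT -[dot x y]opprK lerN2 -dotNl.
by rewrite -(enormN x) dot_le.
Qed.

Lemma enormD x y : enorm (x + y) <= enorm x + enorm y.
Proof.
rewrite -(ler_pXn2r (n:=2))// ?nnegrE ?addr_ge0 ?enorm_ge0//.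
rewrite sqr_enorm sqrrD !sqr_enorm !dot_linear (dotC y x).
by have := dot_le x y; lra.
Qed.

Lemma enorm_tri y x z : enorm (x - z) <= enorm (x - y) + enorm (y - z).
Proof. by have := enormD (x - y) (y - z); rewrite addrA subrK. Qed.

Lemma enorm_coord x i : `|x 0 i| <= enorm x.
Proof.
rewrite -(ler_pXn2r (n:=2))// ?nnegrE ?normr_ge0 ?enorm_ge0//.
rewrite sqr_enorm real_normK ?num_real// /dot (bigD1 i)//= -expr2 lerDl.
by apply: sumr_ge0 => j _; rewrite -expr2 sqr_ge0.
Qed.

Lemma enorm_delta i : enorm (delta_mx 0 i : 'rV[R]_n) = 1.
Proof.
rewrite /enorm /dot (bigD1 i)//= mxE !eqxx mulr1 big1 ?addr0 ?sqrtr1//.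
by move=> j ji; rewrite !mxE eqxx (negbTE ji) mulr0.
Qed.

Lemma dot_delta x i : dot x (delta_mx 0 i) = x 0 i.
Proof.
rewrite /dot (bigD1 i)//= mxE !eqxx mulr1 big1 ?addr0//.
by move=> j ji; rewrite !mxE eqxx (negbTE ji) mulr0.
Qed.

Lemma polarization x y :
  dot x y = (enorm x ^+ 2 + enorm y ^+ 2 - enorm (x - y) ^+ 2) / 2.
Proof. by rewrite !sqr_enorm !dot_linear (dotC y x); field. Qed.

Lemma orthogonal_dot (Q : 'M[R]_n) x y :
  Q *m Q^T = 1%:M -> dot (x *m Q) (y *m Q) = dot x y.
Proof. by move=> QQ; rewrite dotMl -mulmxA QQ mulmx1. Qed.

Lemma orthogonal_enorm (Q : 'M[R]_n) x :
  Q *m Q^T = 1%:M -> enorm (x *m Q) = enorm x.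
Proof. by move=> QQ; rewrite /enorm orthogonal_dot. Qed.

(** By polarization [g = phi - phi 0] preserves [dot], so the images of the basis vectors are the
    rows of an orthogonal [Q]. Expanding the squared norm of [g x - x *m Q] then gives 0. *)
Lemma isometry_affine (phi : 'rV[R]_n -> 'rV[R]_n) :
  (forall x y, enorm (phi x - phi y) = enorm (x - y)) ->
  exists (Q : 'M[R]_n) b, Q *m Q^T = 1%:M /\ forall x, phi x = x *m Q + b.
Proof.
move=> iso; pose g x := phi x - phi 0.
have gN x : enorm (g x) = enorm x by rewrite iso subr0.
have gB x y : enorm (g x - g y) = enorm (x - y).
  by rewrite -(iso x y); congr enorm; rewrite /g opprB addrA subrK.
have gd x y : dot (g x) (g y) = dot x y by rewrite !polarization !gN gB.
pose Q : 'M[R]_n := \matrix_i g (delta_mx 0 i).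
have gQ x : g x *m Q^T = x.
  apply/rowP => i; rewrite -[RHS]dot_delta -gd mxE.
  by apply: eq_bigr => j _; rewrite !mxE.
have QQ : Q *m Q^T = 1%:M.
  by apply/row_matrixP => i; rewrite row_mul rowK gQ row1.
exists Q, (phi 0); split => // x.
apply/eqP; rewrite -subr_eq -/(g x) -subr_eq0 -dotxx_eq0.
clearbody g; rewrite !dot_linear (dotC (x *m Q) (g x)) gd orthogonal_dot//.
by rewrite (dotC (g x)) dotMl gQ; apply/eqP; ring.
Qed.

Lemma orthogonal_tr (Q : 'M[R]_n) : Q *m Q^T = 1%:M -> Q^T *m Q = 1%:M.
Proof. exact: mulmx1C. Qed.

Lemma isometry_eq_near (phi psi : 'rV[R]_n -> 'rV[R]_n) c (r : R) : 0 < r ->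
  (forall x y, enorm (phi x - phi y) = enorm (x - y)) ->
  (forall x y, enorm (psi x - psi y) = enorm (x - y)) ->
  (forall x, enorm (x - c) < r -> phi x = psi x) -> phi =1 psi.
Proof.
move=> r0 /isometry_affine[Q [b [_ hphi]]] /isometry_affine[P [d [_ hpsi]]] h.
have hc : c *m Q + b = c *m P + d.
  by rewrite -hphi -hpsi h// subrr enorm0.
suff QP : Q = P.
  by move=> x; rewrite hphi hpsi QP; move: hc; rewrite QP => /addrI ->.
apply/row_matrixP => i; rewrite !rowE.
have := h (c + (r / 2) *: delta_mx 0 i); rewrite hphi hpsi !mulmxDl -!scalemxAl.
rewrite addrC addKr enormZ enorm_delta mulr1 gtr0_norm ?divr_gt0//.
rewrite ltr_pdivrMr// ltr_pMr// ltr1n => /(_ isT).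
rewrite addrAC hc addrAC => /addIr/addrI/scalerI; apply.
by rewrite gt_eqF// divr_gt0.
Qed.

(** The conclusion is about a whole ball so that the induction closes: the next hyperplane is
    avoided by moving the centre inside the ball already found and shrinking the radius. *)
Lemma generic_point (s : seq ('rV[R]_n * R)) x0 (r : R) : 0 < r ->
  (forall p, p \in s -> p.1 != 0) ->
  exists x, exists2 d : R, 0 < d & forall y, enorm (y - x) < d ->
    enorm (y - x0) < r /\ forall p, p \in s -> dot p.1 y != p.2.
Proof.
move=> r0; elim: s => [|[a c] s IH] hs.
  by exists x0, r.
have [x [d d0 hx]] := IH (fun p ps => hs p (mem_behead (s:=(a,c)::s) ps)).
have a0 : a != 0 by apply: (hs (a, c)); rewrite mem_head.
have ea : 0 < enorm a by rewrite enorm_gt0.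
have [x1 xx1 ax1] : exists2 x1, enorm (x1 - x) < d / 2 & dot a x1 != c.
  have [axc|axc] := eqVneq (dot a x) c; last first.
    by exists x => //; rewrite subrr enorm0 divr_gt0.
  exists (x + (d / 4 / enorm a) *: a).
    rewrite addrC addKr enormZ gtr0_norm ?divr_gt0// mulfVK ?gt_eqF//; lra.
  rewrite dotDr dotZr axc -subr_eq0 addrC addKr.
  by rewrite gt_eqF// mulr_gt0 ?dotxx_gt0// !divr_gt0.
pose e := Num.min (d / 2) (`|dot a x1 - c| / enorm a).
have e0 : 0 < e by rewrite lt_min !divr_gt0 ?normr_gt0 ?subr_eq0.
exists x1, e => // y; rewrite lt_min => /andP[y1 y2].
have yx : enorm (y - x) < d.
  by apply: le_lt_trans (enorm_tri x1 _ _) _; rewrite (splitr d) ltrD.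
have [h1 h2] := hx y yx; split => // p; rewrite inE => /predU1P[->/=|]; last exact: h2.
apply/eqP => ay; move: y2; rewrite ltr_pdivlMr// ltNge => /negP; apply.
rewrite -ay -dotNr -dotDr enormC mulrC; exact: norm_dot_le.
Qed.

End Euclid.

(** * Connectedness arguments on the real line *)

Section RealInduction.
Context {R : realType}.

(** If [S] fails somewhere, the times [t] with [S] on all of [[0, t]] have a supremum. The
    closedness hypothesis gives [S] there, and the openness hypothesis goes beyond it. *)
Lemma real_induction (S : set R) : S 0 ->
  (forall t, 0 <= t -> (forall s, 0 <= s <= t -> S s) ->
     exists2 d, 0 < d & forall s, t <= s < t + d -> S s) ->
  (forall t, 0 < t -> (forall s, 0 <= s < t -> S s) -> S t) ->
  forall t, 0 <= t -> S t.
Proof.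
move=> S0 Sopen Sclosed t0 t00; apply: contrapT => nS.
pose E := [set t : R | 0 <= t /\ forall s, 0 <= s <= t -> S s].
have Elt t : E t -> t < t0.
  by move=> [_ h]; rewrite ltNge; apply/negP => tt; apply: nS; apply: h; rewrite t00.
have E0 : E 0 by split => // s; rewrite -eq_le => /eqP <-.
have hE : has_sup E.
  by split; [exists 0|exists t0 => t /Elt/ltW].
have s0 : 0 <= sup E by apply: sup_upper_bound.
have below s : 0 <= s < sup E -> S s.
  move=> /andP[s1 s2]; have e0 : 0 < sup E - s by rewrite subr_gt0.
  have [t [_ Et]] := sup_adherent e0 hE; rewrite subKr => st.
  by apply: Et; rewrite s1 ltW.
have SE : S (sup E).
  move: s0; rewrite le_eqVlt => /predU1P[<-//|s0]; exact: Sclosed.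
have Eall s : 0 <= s <= sup E -> S s.
  move=> /andP[s1]; rewrite le_eqVlt => /predU1P[->//|s2].
  by apply: below; rewrite s1.
have [d d0 hd] := Sopen _ s0 Eall.
have : E (sup E + d / 2).
  split=> [|s /andP[s1 s2]]; first by rewrite addr_ge0// ltW// divr_gt0.
  have [h|h] := leP s (sup E); first by apply: Eall; rewrite s1.
  apply: hd; rewrite (ltW h)/=; lra.
by move/(ub_le_sup hE.2); lra.
Qed.

Lemma clopen_line (S : set R) : S 0 ->
  (forall t, exists2 d, 0 < d & forall s, `|s - t| < d -> S s <-> S t) ->
  forall t, S t.
Proof.
have pos (S' : set R) : S' 0 ->
  (forall t, exists2 d, 0 < d & forall s, `|s - t| < d -> S' s <-> S' t) ->
  forall t, 0 <= t -> S' t.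
  move=> S0 h; apply: real_induction => // [t t0 ht|t t0 ht].
    have [d d0 hd] := h t; exists d => // s /andP[s1 s2].
    apply/hd; last by apply: ht; rewrite t0 lexx.
    by rewrite ger0_norm ?subr_ge0//; lra.
  have [d d0 hd] := h t; pose s := Num.max 0 (t - d / 2).
  have s1 : 0 <= s by rewrite le_max lexx.
  have s2 : s < t by rewrite gt_max t0/=; lra.
  apply/(hd s); last by apply: ht; rewrite s1.
  have : t - d / 2 <= s by rewrite le_max lexx orbT.
  by rewrite ltr0_norm ?subr_lt0//; lra.
move=> S0 h t; have [t0|t0] := leP 0 t; first exact: pos.
rewrite -[t]opprK; apply: (pos (fun t => S (- t))); rewrite ?oppr0//; last lra.
move=> s; have [d d0 hd] := h (- s); exists d => // s' h'; apply: hd.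
by rewrite -opprD normrN.
Qed.

End RealInduction.

(** * Walls and faces *)

Section Walls.
Context {R : realType} {n : nat} {H : set (set 'rV[R]_n)}.
Context (HW : euclidean_walls H).
Implicit Types (x y z u v a b : 'rV[R]_n) (phi psi w : 'rV[R]_n -> 'rV[R]_n).

(** With a zero normal the left side would be empty or everything. This is needed because
    [walls_hyperplane] provides a nonzero normal for only one of the equations of a wall. *)
Lemma hyperplane_eq_normal a b (c d : R) : b != 0 ->
  hyperplane a c = hyperplane b d -> a != 0.
Proof.
move=> b0 E; have bb : dot b b != 0 by rewrite dotxx_eq0.
apply/eqP => a0; pose x := (d / dot b b) *: b.
have hx : hyperplane b d x by rewrite /hyperplane/= dotZr mulfVK.
have : hyperplane b d (x + b).
  by move: hx; rewrite -E /hyperplane/= a0 !dot0l.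
rewrite /hyperplane/= dotDr (hx : dot b x = d) => /eqP.
by rewrite -subr_eq0 addrC addKr (negbTE bb).
Qed.

Lemma wall_normal_neq0 a c : H (hyperplane a c) -> a != 0.
Proof.
move=> Hac; have [b [d [b0 E]]] := walls_hyperplane HW Hac.
exact: hyperplane_eq_normal b0 E.
Qed.

Lemma walls_seq x r : exists s : seq ('rV[R]_n * R),
  (forall p, p \in s -> H (hyperplane p.1 p.2)) /\
  forall h y, H h -> h y -> enorm (y - x) <= r ->
    exists2 p, p \in s & h = hyperplane p.1 p.2.
Proof.
have /finite_seqP[s0 Es0] := walls_locally_finite HW x r.
pose g h : 'rV[R]_n * R := xget (0, 0) [set p | h = hyperplane p.1 p.2].
have gP h : H h -> h = hyperplane (g h).1 (g h).2.
  move=> /(walls_hyperplane HW)[a [c [_ E]]]; rewrite /g.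
  by case: xgetP => [p _ <-//|/(_ (a, c)) /=]; rewrite E.
have s0H h : h \in s0 -> H h.
  by move=> hs; have : [set` s0] h := hs; rewrite -Es0 => -[].
exists [seq g h | h <- s0]; split.
  by move=> p /mapP[h /s0H Hh ->]; rewrite -gP.
move=> h y Hh hy yx; exists (g h); last exact: gP.
apply: map_f; suff : [set` s0] h by [].
by rewrite -Es0; split => //; exists y.
Qed.

Lemma sg_segment (al be : R) : al != 0 -> Num.sg al != Num.sg be ->
  exists2 t, 0 <= t <= 1 & al + t * (be - al) = 0.
Proof.
move=> al0 sab; have ab : be - al != 0.
  by apply: contraNneq sab => /eqP; rewrite subr_eq0 => /eqP->.
exists (al / (al - be)); last by field; rewrite -oppr_eq0 opprB.
have [h|h|h] := ltgtP al 0; last by rewrite h eqxx in al0.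
- have hb : 0 <= be.
    by rewrite leNgt; apply: contra sab => /ltr0_sg ->; rewrite ltr0_sg.
  rewrite -mulrNN -invrN opprB divr_ge0 ?ler_pdivrMr; lra.
- have hb : be <= 0.
    by rewrite leNgt; apply: contra sab => /gtr0_sg ->; rewrite gtr0_sg.
  rewrite divr_ge0 ?ler_pdivrMr; lra.
Qed.

(** If the sign of a wall not containing [x] changes, the segment from [x] to [y] meets that wall.
    Finitely many walls meet the unit ball, and [d] is chosen so that those avoiding [x] also avoid
    the ball of radius [d]. *)
Lemma face_le_near x : exists2 d : R, 0 < d &
  forall y, enorm (y - x) < d -> face_le H x y.
Proof.
have [s [sH hs]] := walls_seq x 1.
have [d d0 [d1 hd]] : exists2 d : R, 0 < d & d <= 1 /\
    forall p, p \in s -> dot p.1 x = p.2 \/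
      forall y, enorm (y - x) < d -> dot p.1 y <> p.2.
  elim: s sH {hs} => [_|[a c] s IH sH]; first by exists 1.
  have [p ps|d d0 [d1 hd]] := IH; first by apply: sH; rewrite inE ps orbT.
  have a0 : a != 0 by apply: (@wall_normal_neq0 _ c); apply: (sH (a,c)); rewrite mem_head.
  have ea : 0 < enorm a by rewrite enorm_gt0.
  have [axc|axc] := eqVneq (dot a x) c.
    exists d => //; split => // p; rewrite inE => /predU1P[->|]; last exact: hd.
    by left.
  exists (Num.min d (`|dot a x - c| / enorm a)).
    by rewrite lt_min d0 divr_gt0// normr_gt0 subr_eq0.
  split=> [|p]; first by rewrite ge_min d1.
  rewrite inE => /predU1P[->/=|/hd[|h]]; [|by left|]; right => y; rewrite lt_min => /andP[y1 y2];
    last exact: h.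
  move=> ay; move: y2; rewrite ltr_pdivlMr// ltNge => /negP; apply.
  rewrite -ay -dotNr -dotDr enormC mulrC; exact: norm_dot_le.
exists d => // y yx a c Hac; have [|/eqP axc] := EM (dot a x = c); first by left.
right; apply/eqP/negPn/negP; rewrite eq_sym => sg.
have ax0 : dot a x - c != 0 by rewrite subr_eq0.
rewrite eq_sym in sg.
have [t /andP[t0 t1] ht] := sg_segment ax0 sg.
pose z := x + t *: (y - x).
have zx : enorm (z - x) < d.
  rewrite /z addrC addKr enormZ ger0_norm//; apply: le_lt_trans yx.
  by rewrite -[leRHS]mul1r ler_wpM2r ?enorm_ge0.
have az : dot a z = c.
  by apply/eqP; rewrite -subr_eq0 -[X in _ == X]ht /z !dot_linear; apply/eqP; ring.
have [p ps E] := hs _ z Hac az (ltW (lt_le_trans zx d1)).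
have hz : hyperplane p.1 p.2 z by rewrite -E.
have [h|/(_ z zx)//] := hd p ps.
by move/eqP: axc; apply; have : hyperplane p.1 p.2 x := h; rewrite -E.
Qed.

Lemma face_le_trans x y z : face_le H x y -> face_le H y z -> face_le H x z.
Proof.
move=> xy yz a c Hac; have [->|xc] := eqVneq (dot a x) c; [by left|right].
have [/eqP|E] := xy a c Hac; first by rewrite (negbTE xc).
rewrite E; have [yc|//] := yz a c Hac.
by move/eqP: E; rewrite yc subrr sgr0 sgr_eq0 subr_eq0 (negbTE xc).
Qed.

Lemma face_refl x : face H x x.
Proof. by []. Qed.

Lemma face_sym x y : face H x y -> face H y x.
Proof. by move=> h a c Hac; rewrite h. Qed.

Lemma face_trans x y z : face H x y -> face H y z -> face H x z.
Proof. by move=> h k a c Hac; rewrite (k _ _ Hac) h. Qed.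

Lemma face_eq x y : face H x y -> face H x = face H y.
Proof.
move=> h; apply/seteqP; split => z; apply: face_trans => //; exact: face_sym.
Qed.

Lemma chamber_face_le c y : in_chamber H c -> face_le H c y -> face H c y.
Proof. by move=> Hc h a d Had; have [/(Hc _ Had)//|->] := h a d Had. Qed.

Lemma chamber_face c y : in_chamber H c -> face H c y -> in_chamber H y.
Proof.
move=> Hc h k Hk; have [a [d [_ E]]] := walls_hyperplane HW Hk.
rewrite E in Hk *; have /eqP := h a d Hk; rewrite /hyperplane/= => + yd.
by rewrite yd subrr sgr0 eq_sym sgr_eq0 subr_eq0 => /eqP; apply: Hc Hk.
Qed.

Lemma chamber_open c : in_chamber H c -> exists2 d : R, 0 < d &
  forall y, enorm (y - c) < d -> face H c y.
Proof.
move=> Hc; have [d d0 hd] := face_le_near c.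
by exists d => // y /hd; apply: chamber_face_le.
Qed.

Lemma chamber_near x (r : R) : 0 < r ->
  exists c, [/\ enorm (c - x) < r, in_chamber H c & face_le H x c].
Proof.
move=> r0; have [d d0 hd] := face_le_near x.
have [s [sH hs]] := walls_seq x 1.
have e0 : 0 < Num.min r (Num.min d 1) by rewrite !lt_min r0 d0 ltr01.
have [p ps|c [d' d'0 hc]] := generic_point (s := s) x e0.
  exact: wall_normal_neq0 (sH p ps).
exists c; have [] := hc c; first by rewrite subrr enorm0.
rewrite !lt_min => /and3P[c1 c2 c3] hp; split => //; last exact: hd.
move=> h Hh hc'; have [p ps E] := hs h c Hh hc' (ltW c3).
by have /eqP := hp p ps; apply; rewrite E in hc'.
Qed.

Lemma segment_face x c (t : R) : 0 < t <= 1 -> face_le H x c ->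
  face H c (x + t *: (c - x)).
Proof.
move=> /andP[t0 t1] h a d Had.
have -> : dot a (x + t *: (c - x)) - d =
  (1 - t) * (dot a x - d) + t * (dot a c - d) by rewrite !dot_linear; ring.
have [->|E] := h a d Had; first by rewrite subrr mulr0 add0r sgrM gtr0_sg// mul1r.
move: E; case: (sgrP (dot a c - d)) => [c0 /eqP|c0 /eqP|c0 /eqP]; rewrite sgr_cp0.
- by rewrite c0 => /eqP->; rewrite !mulr0 addr0 sgr0.
- move=> x0; apply/eqP; rewrite sgr_cp0; nra.
- move=> x0; apply/eqP; rewrite sgr_cp0; nra.
Qed.

(* Locally there are finitely many walls, and a generic point of [hyperplane a c] avoids
   those that do not contain it. *)
Lemma covered_hyperplane a c : a != 0 ->
  (forall x, dot a x = c -> ~ in_chamber H x) -> H (hyperplane a c).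
Proof.
move=> a0 hin; have aa : dot a a != 0 by rewrite dotxx_eq0.
have ea : 0 < enorm a by rewrite enorm_gt0.
apply: contrapT => nH; pose x0 := (c / dot a a) *: a.
have ax0 : dot a x0 = c by rewrite dotZr mulfVK.
have [s [sH hs]] := walls_seq x0 1.
(* [b - la b *: a] is the component of [b] orthogonal to [a], so [s'] lists the traces of the nearby
   walls on [hyperplane a c]. The parallel walls, which have no such trace, are filtered out. The
   point [y] below is the projection of the generic [y0] to that hyperplane. *)
pose la b := dot b a / dot a a.
pose s' := [seq q <- [seq (p.1 - la p.1 *: a, p.2 - la p.1 * c) | p <- s] | q.1 != 0].
have h4 : 0 < 1 / 4 :> R by lra.
have [p|y0 [d d0 hy]] := generic_point (s := s') x0 h4.
  by rewrite mem_filter => /andP[].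
have [|y01 y02] := hy y0; first by rewrite subrr enorm0.
pose y := y0 - ((dot a y0 - c) / dot a a) *: a.
have ay : dot a y = c by rewrite /y !dot_linear mulfVK// subKr.
have yx : enorm (y - x0) <= 1.
  have -> : y - x0 = (y0 - x0) - (dot a (y0 - x0) / dot a a) *: a.
    by rewrite dotDr dotNr ax0 /y addrAC.
  apply: le_trans (enormD _ _) _; rewrite enormN enormZ.
  suff : `|dot a (y0 - x0) / dot a a| * enorm a <= enorm (y0 - x0) by lra.
  rewrite normrM normfV -sqr_enorm (ger0_norm (sqr_ge0 _)) expr2 invfM !mulrA.
  by rewrite mulfVK ?gt_eqF// ler_pdivrMr// mulrC norm_dot_le.
apply: (hin y ay) => h Hh hy'; have [p ps E] := hs h y Hh hy' yx.
rewrite E /hyperplane/= in hy'.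
have [b0|b0] := eqVneq (p.1 - la p.1 *: a) 0.
  have pE : p.1 = la p.1 *: a by apply/eqP; rewrite -subr_eq0 b0.
  apply: nH; suff -> : hyperplane a c = hyperplane p.1 p.2 by exact: sH.
  have l0 : la p.1 != 0.
    by have := wall_normal_neq0 (sH p ps); rewrite [in X in X -> _]pE scaler_eq0 negb_or => /andP[].
  move: (la p.1) pE l0 => l pE l0; rewrite -hy' pE.
  apply/seteqP; split => z; rewrite /hyperplane/= !dotZl ay; [by move=> ->|by move/(mulfI l0)].
have /y02/eqP : (p.1 - la p.1 *: a, p.2 - la p.1 * c) \in s'.
  by rewrite mem_filter b0/=; apply: (map_f (fun p => (p.1 - la p.1 *: a, p.2 - la p.1 * c))).
apply => /=; rewrite -hy' -ay /y !dot_linear (mulfVK aa) /la; field.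
exact: aa.
Qed.

(** The last condition is about equations instead of images of sets: the hyperplane in it is the
    image of [hyperplane a c], by [image_hyperplane]. Being an equivalence, it passes to the inverse
    map. *)
Definition wall_isometry phi := exists (Q : 'M[R]_n) b,
  [/\ Q *m Q^T = 1%:M, forall x, phi x = x *m Q + b &
   forall a c, H (hyperplane (a *m Q) (c + dot (a *m Q) b)) <-> H (hyperplane a c)].

Lemma image_hyperplane phi (Q : 'M[R]_n) b a c : Q *m Q^T = 1%:M ->
  (forall x, phi x = x *m Q + b) ->
  phi @` hyperplane a c = hyperplane (a *m Q) (c + dot (a *m Q) b).
Proof.
move=> QQ E; apply/seteqP; split => [_ [x + <-]|y]; rewrite /hyperplane/=.
  by rewrite E dotDr orthogonal_dot// => ->.
move=> hy; exists ((y - b) *m Q^T).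
  by rewrite dotC dotMl trmxK dotC dotDr dotNr hy addrK.
by rewrite E -mulmxA (orthogonal_tr QQ) mulmx1 subrK.
Qed.

Lemma wall_isometryI phi psi :
  (forall x y, enorm (phi x - phi y) = enorm (x - y)) ->
  cancel phi psi ->
  (forall h, H h -> H (phi @` h)) -> (forall h, H h -> H (psi @` h)) ->
  wall_isometry phi.
Proof.
move=> /isometry_affine[Q [b [QQ E]]] K hphi hpsi; exists Q, b; split => // a c.
rewrite -(image_hyperplane _ _ QQ E); split => [/hpsi|]; last exact: hphi.
by rewrite image_comp (_ : psi \o phi = id) ?image_id//; apply/funext.
Qed.

Lemma wall_isometry_iso phi : wall_isometry phi ->
  forall x y, enorm (phi x - phi y) = enorm (x - y).
Proof.
move=> [Q [b [QQ E _]]] x y.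
by rewrite !E opprD addrACA subrr addr0 -mulmxBl orthogonal_enorm.
Qed.

Lemma wall_isometry_id : wall_isometry id.
Proof.
exists 1%:M, 0; split => [|x|a c]; first by rewrite trmx1 mulmx1.
  by rewrite mulmx1 addr0.
by rewrite mulmx1 dot0r addr0.
Qed.

Lemma wall_isometry_comp phi psi :
  wall_isometry phi -> wall_isometry psi -> wall_isometry (phi \o psi).
Proof.
move=> [Q [b [QQ E h]]] [P [d [PP F k]]]; exists (P *m Q), (d *m Q + b); split.
- by rewrite trmx_mul mulmxA -(mulmxA P) QQ mulmx1.
- by move=> x; rewrite /= E F mulmxDl mulmxA addrA.
- by move=> a c; rewrite -(k a c) -(h (a *m P)) !mulmxA dotDr orthogonal_dot// addrA.
Qed.

Lemma wall_isometry_inv phi : wall_isometry phi ->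
  exists psi, [/\ wall_isometry psi, cancel phi psi & cancel psi phi].
Proof.
move=> [Q [b [QQ E h]]]; exists (fun x => (x - b) *m Q^T); split.
- exists Q^T, (- (b *m Q^T)); split; first by rewrite trmxK orthogonal_tr.
    by move=> x; rewrite mulmxBl.
  move=> a c; rewrite -h -mulmxA (orthogonal_tr QQ) mulmx1 dotNr.
  by rewrite orthogonal_dot ?trmxK ?orthogonal_tr// subrK.
- by move=> x; rewrite E addrK -mulmxA QQ mulmx1.
- by move=> x; rewrite E -mulmxA (orthogonal_tr QQ) mulmx1 subrK.
Qed.

Lemma wall_isometry_pull phi a' c' : wall_isometry phi -> H (hyperplane a' c') ->
  exists a c, H (hyperplane a c) /\ forall x, dot a' (phi x) - c' = dot a x - c.
Proof.
move=> [Q [b [QQ E h]]] H'; exists (a' *m Q^T), (c' - dot a' b); split.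
  by rewrite -h -mulmxA (orthogonal_tr QQ) mulmx1 subrK.
by move=> x; rewrite E dotMl trmxK dotDr opprB addrA addrAC.
Qed.

End Walls.

(** * Action of wall isometries on faces and chambers *)

Section WallIsometries.
Context {R : realType} {n : nat} {H : set (set 'rV[R]_n)}.
Context (HW : euclidean_walls H).
Implicit Types (x y z u v a b : 'rV[R]_n) (phi psi w : 'rV[R]_n -> 'rV[R]_n).
Local Notation wall_isometry := (wall_isometry (H := H)).

Lemma wall_isometry_face phi u z : wall_isometry phi ->
  face H (phi u) (phi z) <-> face H u z.
Proof.
have fwd psi x y : wall_isometry psi -> face H x y -> face H (psi x) (psi y).
  move=> hpsi h a c Hac; have [b [d [Hbd E]]] := wall_isometry_pull hpsi Hac.
  by rewrite !E; apply: h.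
move=> hphi; split; last exact: fwd.
have [psi [hpsi K _]] := wall_isometry_inv hphi.
by move=> /(fwd _ _ _ hpsi); rewrite !K.
Qed.

Lemma wall_isometry_face_le phi u z : wall_isometry phi ->
  face_le H (phi u) (phi z) <-> face_le H u z.
Proof.
have fwd psi x y : wall_isometry psi -> face_le H x y -> face_le H (psi x) (psi y).
  move=> hpsi h a c Hac; have [b [d [Hbd E]]] := wall_isometry_pull hpsi Hac.
  rewrite !E; have [xd|xd] := h _ _ Hbd; [left|by right].
  by apply/eqP; rewrite -subr_eq0 E xd subrr.
move=> hphi; split; last exact: fwd.
have [psi [hpsi K _]] := wall_isometry_inv hphi.
by move=> /(fwd _ _ _ hpsi); rewrite !K.
Qed.

Lemma wall_isometry_chamber phi u : wall_isometry phi ->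
  in_chamber H (phi u) <-> in_chamber H u.
Proof.
have fwd psi x : wall_isometry psi -> in_chamber H x -> in_chamber H (psi x).
  move=> hpsi h k Hk; have [a [c [_ E]]] := walls_hyperplane HW Hk.
  rewrite E in Hk *; have [b [d [Hbd E']]] := wall_isometry_pull hpsi Hk.
  move=> /eqP; rewrite -subr_eq0 E' subr_eq0 => /eqP; exact: h Hbd.
move=> hphi; split; last exact: fwd.
have [psi [hpsi K _]] := wall_isometry_inv hphi.
by move=> /(fwd _ _ hpsi); rewrite !K.
Qed.

Lemma reflectionK a c : a != 0 -> involutive (reflection a c).
Proof.
move=> a0 x; have aa : dot a a != 0 by rewrite dotxx_eq0.
rewrite /reflection !dot_linear -addrA -opprD -scalerDl.
set k := (X in X *: a); suff -> : k = 0 by rewrite scale0r subr0.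
by rewrite /k; field.
Qed.

Lemma reflection_iso a c x y : a != 0 ->
  enorm (reflection a c x - reflection a c y) = enorm (x - y).
Proof.
move=> a0; have aa : dot a a != 0 by rewrite dotxx_eq0.
rewrite /enorm; congr Num.sqrt; rewrite /reflection !dot_linear.
rewrite (dotC x a) (dotC y a) (dotC y x); field; exact: aa.
Qed.

Lemma reflection_group_wall_isometry w : reflection_group H w -> wall_isometry w.
Proof.
elim=> [|a c {}w Hac _ IH]; first exact: wall_isometry_id.
apply: wall_isometry_comp => //; have a0 := wall_normal_neq0 HW Hac.
apply: (wall_isometryI (psi := reflection a c)) => [x y||h Hh|h Hh].
- exact: reflection_iso.
- exact: reflectionK.
- exact: walls_reflection.
- exact: walls_reflection.
Qed.

Lemma wall_isometry_eq phi psi c : wall_isometry phi -> wall_isometry psi ->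
  in_chamber H c -> (forall z, face H c z -> phi z = psi z) -> phi =1 psi.
Proof.
move=> hphi hpsi /(chamber_open HW)[d d0 hd] h.
apply: (isometry_eq_near d0) => [x y|x y|x /hd]; last exact: h.
- exact: wall_isometry_iso hphi x y.
- exact: wall_isometry_iso hpsi x y.
Qed.

End WallIsometries.

(** * Charts *)

Section Charts.
Context {R : realType} {n : nat} {H : set (set 'rV[R]_n)}.
Context (HW : euclidean_walls H).
Context {X : metricType R} {A : set ('rV[R]_n -> X)}.
Context (BA : building_atlas H A).
Implicit Types (x y z u v c : 'rV[R]_n) (phi psi w : 'rV[R]_n -> 'rV[R]_n).
Implicit Types (f k F : 'rV[R]_n -> X).
Local Notation wall_isometry := (wall_isometry (H := H)).

Definition isometric F := forall u v, mdist (F u) (F v) = enorm (u - v).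

Lemma chart_isometric f : A f -> isometric f.
Proof. exact: atlas_isometric BA f. Qed.

Lemma chart_comp f w : A f -> reflection_group H w -> A (f \o w).
Proof. exact: (atlas_comp BA). Qed.

Lemma isometric_inj F : isometric F -> injective F.
Proof.
move=> iF u v E; apply/eqP; rewrite -subr_eq0 -enorm_eq0 -iF E.
by rewrite mdistxx.
Qed.

Lemma mdist_small (p q : X) : (forall e : R, 0 < e -> mdist p q <= e) -> p = q.
Proof.
move=> h; apply: mdist_positivity; apply/eqP; rewrite eq_le mdist_ge0 andbT.
by apply/ler_addgt0Pl => e e0; rewrite addr0 h.
Qed.

Lemma agree_closed F1 F2 (E : set 'rV[R]_n) x :
  isometric F1 -> isometric F2 -> (forall z, E z -> F1 z = F2 z) ->
  (forall e : R, 0 < e -> exists2 z, E z & enorm (z - x) <= e) -> F1 x = F2 x.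
Proof.
move=> i1 i2 h hx; apply: mdist_small => e e0.
have [|z Ez zx] := hx (e / 2); first by rewrite divr_gt0.
apply: le_trans (metric_triangle _ (F1 z) _) _.
by rewrite i1 (h _ Ez) i2 enormC; lra.
Qed.

Lemma agree_closure F1 F2 x c : isometric F1 -> isometric F2 -> face_le H x c ->
  (forall z, face H c z -> F1 z = F2 z) -> F1 x = F2 x.
Proof.
move=> i1 i2 xc h; apply: (agree_closed i1 i2 h) => e e0.
pose m := enorm (c - x) + 1; have m0 : 0 < m by rewrite ltr_wpDl ?enorm_ge0.
pose t := Num.min 1 (e / m).
have t0 : 0 < t by rewrite lt_min ltr01 divr_gt0.
exists (x + t *: (c - x)); first by apply: segment_face; rewrite ?t0 ?ge_min ?lexx.
rewrite addrC addKr enormZ gtr0_norm//.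
apply: (@le_trans _ _ (e / m * m)); last by rewrite mulfVK ?gt_eqF.
rewrite ler_pM ?(ltW t0) ?enorm_ge0//; first by rewrite ge_min lexx orbT.
by rewrite lerDl.
Qed.

Lemma chart_change f k u v : A f -> A k -> range k (f u) -> range k (f v) ->
  exists w, [/\ reflection_group H w, wall_isometry w &
    forall z, face H u z \/ face H v z -> k (w z) = f z].
Proof.
move=> Af Ak ku kv; have [w [hw E]] := atlas_change BA Af Ak ku kv.
by exists w; split => //; apply: reflection_group_wall_isometry.
Qed.

Lemma chart_normalize f k c : A f -> A k -> range k (f c) ->
  exists k', [/\ A k', range k' = range k & forall z, face H c z -> k' z = f z].
Proof.
move=> Af Ak kc; have [w [hw iw E]] := chart_change Af Ak kc kc.
exists (k \o w); split; first exact: chart_comp.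
  apply/seteqP; split => [_ [z _ <-]|_ [z _ <-]]; first by exists (w z).
  by have [w' [_ _ K]] := wall_isometry_inv iw; exists (w' z) => //=; rewrite K.
by move=> z cz; apply: E; left.
Qed.

(** The transition map for the pair [c], [v] is the identity on the open chamber of [c], hence
    everywhere. *)
Lemma chart_agree_face f k c v : A f -> A k -> in_chamber H c ->
  (forall z, face H c z -> f z = k z) -> f v = k v ->
  forall z, face H v z -> f z = k z.
Proof.
move=> Af Ak Hc fk fkv z vz.
have kc : range k (f c) by exists c => //; rewrite fk.
have kv : range k (f v) by exists v => //; rewrite fkv.
have [w [_ iw E]] := chart_change Af Ak kc kv.
have w1 : w =1 id.
  apply: (wall_isometry_eq HW iw wall_isometry_id Hc) => y cy.
  by apply: (isometric_inj (chart_isometric Ak)); rewrite E ?fk//; left.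
by rewrite -E ?w1//; right.
Qed.

Lemma range_isometric F1 F2 : isometric F1 -> isometric F2 ->
  range F1 `<=` range F2 -> exists phi,
  (forall x y, enorm (phi x - phi y) = enorm (x - y)) /\ forall z, F2 (phi z) = F1 z.
Proof.
move=> i1 i2 h.
have /choice[phi E] : forall z, exists y, F2 y = F1 z.
  by move=> z; have [|y _ <-] := h (F1 z); [exists z|exists y].
by exists phi; split => // x y; rewrite -i2 !E i1.
Qed.

Context (CA : complete_atlas H A).

Lemma chart_exists : exists f, A f.
Proof. exact: (atlas_nonempty BA). Qed.

(* The maps that are locally charts form an atlas with the same simplices. *)
Lemma complete_local F :
  (forall u v, exists2 f, A f & forall z, face H u z \/ face H v z -> F z = f z) ->
  A F.
Proof.
pose A' : set ('rV[R]_n -> X) := [set F | forall u v, exists2 f, A f &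
   forall z, face H u z \/ face H v z -> F z = f z].
move=> A'F; have {A'F} : A' F := A'F.
have i' F' : A' F' -> isometric F'.
  move=> h u v; have [f Af E] := h u v.
  by rewrite !E ?chart_isometric//; [right|left].
have AA' : A `<=` A' by move=> f Af u v; exists f.
have BA' : building_atlas H A'.
  split.
  - by have [f Af] := chart_exists; exists f; apply: AA'.
  - exact: i'.
  - move=> f w A'f hw u v; have iw := reflection_group_wall_isometry HW hw.
    have [f' Af' E] := A'f (w u) (w v); exists (f' \o w); first exact: chart_comp.
    by move=> z h; rewrite /= E// !wall_isometry_face.
  - move=> x y; have [f [Af fx fy]] := atlas_pair BA x y.
    by exists f; split => //; apply: AA'.
  - move=> f g u v A'f A'g [a _ ga] [b _ gb].
    have [f1 Af1 E1] := A'f u v; have [g1 Ag1 E2] := A'g a b.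
    have ga1 : g1 a = f1 u by rewrite -E2 ?ga ?E1//; left.
    have gb1 : g1 b = f1 v by rewrite -E2 ?gb ?E1//; right.
    have [||w [hw iw E]] := chart_change Af1 Ag1 (u := u) (v := v).
    + by exists a.
    + by exists b.
    exists w; split => // z uv.
    have wu : w u = a.
      by apply: (isometric_inj (chart_isometric Ag1)); rewrite E ?ga1//; left.
    have wv : w v = b.
      by apply: (isometric_inj (chart_isometric Ag1)); rewrite E ?gb1//; right.
    rewrite E2; first by rewrite E// -E1.
    by rewrite -wu -wv !wall_isometry_face.
have sA' : simplices H A' = simplices H A.
  apply/seteqP; split => _ [f [u [Af ->]]]; last by exists f, u; split => //; exact: AA'.
  have [f' Af' E] := Af u u; exists f', u; split => //.
  by apply/seteqP; split => _ [z uz <-]; exists z => //; rewrite E//; left.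
move=> A'F; have [f Af EF] : apartments A (range F).
  by apply: (CA BA' sA'); exists F.
have [phi [iphi E]] : exists phi, (forall x y, enorm (phi x - phi y) = enorm (x - y)) /\
    forall z, f (phi z) = F z.
  by apply: range_isometric; [exact: i'|exact: chart_isometric|rewrite EF].
have [c [_ Hc _]] := chamber_near HW 0 ltr01.
have [w [hw wE]] : exists w, reflection_group H w /\
    forall z, face H c z \/ face H c z -> f (w z) = F z.
  by apply: (atlas_change BA' A'F (AA' _ Af)); rewrite EF; exists c.
suff -> : F = f \o w by exact: chart_comp.
apply/funext => z; rewrite -E /=; congr f.
have [d d0 hd] := chamber_open HW Hc.
apply: (isometry_eq_near d0) z => // [x y|z /hd cz].
  by apply: (wall_isometry_iso (H := H)); apply: reflection_group_wall_isometry.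
by apply: (isometric_inj (chart_isometric Af)); rewrite E wE//; left.
Qed.

(* Automorphisms need not preserve types, so they map charts to charts only up to an isometry
   of the model apartment that permutes the walls. *)
Definition twisted_chart F := exists f phi,
  [/\ A f, wall_isometry phi & forall z, F z = f (phi z)].

Lemma chart_twisted f : A f -> twisted_chart f.
Proof. by move=> Af; exists f, id; split => //; apply: wall_isometry_id. Qed.

Lemma twisted_isometric F : twisted_chart F -> isometric F.
Proof.
move=> [f [phi [Af hphi E]]] u v.
by rewrite !E chart_isometric// (wall_isometry_iso hphi).
Qed.

Lemma twisted_comp F phi : twisted_chart F -> wall_isometry phi -> twisted_chart (F \o phi).
Proof.
move=> [f [psi [Af hpsi E]]] hphi; exists f, (psi \o phi); split => //.
  exact: wall_isometry_comp.
by move=> z; rewrite /= E.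
Qed.

Lemma twisted_change F1 F2 u v : twisted_chart F1 -> twisted_chart F2 ->
  range F2 (F1 u) -> range F2 (F1 v) -> exists phi, wall_isometry phi /\
    forall z, face H u z \/ face H v z -> F2 (phi z) = F1 z.
Proof.
move=> [f1 [p1 [A1 h1 E1]]] [f2 [p2 [A2 h2 E2]]] [a _ ha] [b _ hb].
have [||w [_ iw E]] := chart_change A1 A2 (u := p1 u) (v := p1 v).
- by exists (p2 a); rewrite // -E1 -E2.
- by exists (p2 b); rewrite // -E1 -E2.
have [q2 [i2 K2 K2']] := wall_isometry_inv h2.
exists (q2 \o (w \o p1)); split.
  by do 2! apply: wall_isometry_comp => //.
by move=> z uv; rewrite E1 E2 /= K2' E// !wall_isometry_face.
Qed.

Lemma twisted_agree_face F1 F2 c v : twisted_chart F1 -> twisted_chart F2 ->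
  in_chamber H c -> (forall z, face H c z -> F1 z = F2 z) -> F1 v = F2 v ->
  forall z, face H v z -> F1 z = F2 z.
Proof.
move=> t1 t2 Hc E Ev z vz.
have [||phi [hphi Ephi]] := twisted_change t1 t2 (u := c) (v := v).
- by exists c => //; rewrite E.
- by exists v => //; rewrite Ev.
have p1 : phi =1 id.
  apply: (wall_isometry_eq HW hphi wall_isometry_id Hc) => y cy.
  by apply: (isometric_inj (twisted_isometric t2)); rewrite Ephi ?E//; left.
by rewrite -Ephi ?p1//; right.
Qed.

(* Completeness gives a chart [f'] with the range of [g \o f]; the transition map sends faces to
   faces, hence chambers to chambers, hence walls to hyperplanes covered by walls. *)
Lemma automorphism_twisted (g g' : X -> X) f : automorphism H A g ->
  automorphism H A g' -> cancel g g' -> cancel g' g -> A f -> twisted_chart (g \o f).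
Proof.
move=> [_ ig sg] [_ ig' sg'] K K' Af.
pose Ag : set ('rV[R]_n -> X) := [set g \o f | f in A].
have BAg : building_atlas H Ag.
  split.
  - by exists (g \o f); exists f.
  - by move=> _ [f' Af' <-] u v; rewrite /= ig chart_isometric.
  - by move=> _ w [f' Af' <-] hw; exists (f' \o w) => //; apply: chart_comp.
  - move=> x y; have [f' [Af' [u _ hx] [v _ hy]]] := atlas_pair BA (g' x) (g' y).
    exists (g \o f'); split; first by exists f'.
      by exists u; rewrite //= hx K'.
    by exists v; rewrite //= hy K'.
  - move=> _ _ u v [f1 A1 <-] [f2 A2 <-] [a _ /= ha] [b _ /= hb].
    have [||w [hw E]] := atlas_change BA A1 A2 (u := u) (v := v).
    + by exists a => //; apply: (can_inj K).
    + by exists b => //; apply: (can_inj K).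
    by exists w; split => // z uv; rewrite /= E.
have sAg : simplices H Ag = simplices H A.
  apply/seteqP; split => [_ [_ [u [[f' Af' <-] ->]]]|s hs].
    by rewrite -image_comp; apply: sg; exists f', u.
  have [f' [u [Af' E]]] := sg' s hs.
  exists (g \o f'), u; split; first by exists f'.
  rewrite -image_comp -E image_comp (_ : g \o g' = id) ?image_id//.
  exact/funext.
have [f' Af' Ef'] : apartments A (range (g \o f)).
  by apply: (CA BAg sAg); exists (g \o f) => //; exists f.
have iF : isometric (g \o f) by move=> u v; rewrite /= ig chart_isometric.
have if' := chart_isometric Af'.
have [|phi [iphi E]] := range_isometric iF if'; first by rewrite Ef'.
have [|psi [ipsi E']] := range_isometric if' iF; first by rewrite Ef'.
have PK : cancel phi psi.
  by move=> z; apply: (isometric_inj iF); rewrite E' E.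
have PK' : cancel psi phi.
  by move=> z; apply: (isometric_inj if'); rewrite E E'.
(* [g \o f] maps the face onto a simplex, read in some chart [k]. The transition from [k] to [f'] is
   a wall isometry, so it turns this simplex into a face of the model. *)
have pface u : phi @` face H u = face H (phi u).
  have [k [v [Ak Ekv]]] : simplices H A ((g \o f) @` face H u).
    by rewrite -image_comp; apply: sg; exists f, u.
  have [v1 vv1 Ev1] : (k @` face H v) ((g \o f) u) by rewrite -Ekv; exists u.
  rewrite (face_eq vv1) in Ekv.
  have [||w [_ iw Ew]] := chart_change Ak Af' (u := v1) (v := v1).
  - by exists (phi u); rewrite // E Ev1.
  - by exists (phi u); rewrite // E Ev1.
  have wv1 : w v1 = phi u.
    by apply: (isometric_inj if'); rewrite E Ew ?Ev1//; left.
  have [w' [iw' WK WK']] := wall_isometry_inv iw.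
  apply/seteqP; split => [_ [z uz <-]|y hy].
    have [z' v1z' Ez'] : (k @` face H v1) ((g \o f) z) by rewrite -Ekv; exists z.
    suff -> : phi z = w z' by rewrite -wv1 wall_isometry_face.
    by apply: (isometric_inj if'); rewrite E Ew ?Ez'//; left.
  rewrite -wv1 -(WK' y) wall_isometry_face// in hy.
  have [z uz Ez] : ((g \o f) @` face H u) (k (w' y)) by rewrite Ekv; exists (w' y).
  exists z => //; apply: (isometric_inj if').
  by rewrite E Ez -Ew ?WK'//; left.
(* A point of a wall has points of other faces arbitrarily near, whereas a chamber is open. Since
   [phi] matches faces, it cannot exchange the two situations. *)
have cham u : in_chamber H (phi u) -> in_chamber H u.
  move=> /[dup] Hu /(chamber_open HW)[d d0 hd] h Hh.
  have [a [c [a0 Eh]]] := walls_hyperplane HW Hh.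
  rewrite Eh in Hh *; rewrite /hyperplane/= => au.
  pose v := u + (d / 2 / enorm a) *: a.
  have ea : 0 < enorm a by rewrite enorm_gt0.
  have : face H (phi u) (phi v).
    apply: hd; rewrite iphi addrC addKr enormZ gtr0_norm ?divr_gt0//.
    rewrite mulfVK ?gt_eqF//; lra.
  rewrite -pface => -[v' uv' /(can_inj PK) vv']; rewrite vv' in uv'.
  have := uv' _ _ Hh; rewrite au subrr sgr0 /v dotDr dotZr au addrC addKr.
  by move/eqP; rewrite sgr_eq0 gt_eqF// mulr_gt0 ?dotxx_gt0// !divr_gt0.
have cham' u : in_chamber H u -> in_chamber H (phi u).
  move=> /[dup] Hu /(chamber_open HW)[d d0 hd] h Hh.
  have [a [c [a0 Eh]]] := walls_hyperplane HW Hh.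
  rewrite Eh in Hh *; rewrite /hyperplane/= => au.
  pose v := psi (phi u + (d / 2 / enorm a) *: a).
  have ea : 0 < enorm a by rewrite enorm_gt0.
  have uv : face H u v.
    apply: hd; rewrite -iphi PK' addrC addKr enormZ gtr0_norm ?divr_gt0//.
    rewrite mulfVK ?gt_eqF//; lra.
  have : face H (phi u) (phi v) by rewrite -pface; exists v.
  move=> /(_ _ _ Hh); rewrite au subrr sgr0 /v PK' dotDr dotZr au addrC addKr.
  by move/eqP; rewrite sgr_eq0 gt_eqF// mulr_gt0 ?dotxx_gt0// !divr_gt0.
have walls p q : (forall x y, enorm (p x - p y) = enorm (x - y)) -> cancel q p ->
    (forall u, in_chamber H (p u) -> in_chamber H u) -> forall h, H h -> H (p @` h).
  move=> /isometry_affine[Q [b [QQ Ep]]] qK pc h Hh.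
  have [a [c [a0 Eh]]] := walls_hyperplane HW Hh.
  rewrite Eh in Hh *; rewrite (image_hyperplane _ _ QQ Ep).
  apply: covered_hyperplane => //.
    by rewrite -enorm_eq0 orthogonal_enorm// enorm_eq0.
  move=> x hx; rewrite -(qK x) => /pc; apply: (_ : ~ _); move=> /(_ _ Hh); apply.
  have : (p @` hyperplane a c) x by rewrite (image_hyperplane _ _ QQ Ep).
  move=> [z hz <-]; suff -> : q (p z) = z by [].
  have inj : injective p.
    move=> s t st; rewrite !Ep in st; move/addIr: st => /(congr1 (mulmx^~ Q^T)).
    by rewrite -!mulmxA QQ !mulmx1.
  by apply: inj; rewrite qK.
exists f', phi; split => //; apply: (wall_isometryI (psi := psi)) => //.
  exact: (walls phi psi).
by apply: (walls psi phi) => // u /cham'; rewrite PK'.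
Qed.

End Charts.

(** * Non-positive curvature *)

Section NonPositiveCurvature.
Context {R : realType} {n : nat} {H : set (set 'rV[R]_n)}.
Context (HW : euclidean_walls H).
Context {X : metricType R} {A : set ('rV[R]_n -> X)}.
Context (BA : building_atlas H A).
Implicit Types (x y z u v c : 'rV[R]_n) (phi psi w : 'rV[R]_n -> 'rV[R]_n).
Implicit Types (f k F : 'rV[R]_n -> X).

(** Distances to each centre [v] are preserved near [v], so the image of a segment is a path of the
    same length. Real induction along the segment adds up the pieces. *)
Lemma local_isometry_lipschitz (theta : 'rV[R]_n -> 'rV[R]_n) :
  (forall v, exists2 d : R, 0 < d & forall v', enorm (v' - v) < d ->
     enorm (theta v' - theta v) = enorm (v' - v)) ->
  forall a b, enorm (theta a - theta b) <= enorm (a - b).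
Proof.
move=> loc a b; pose D := enorm (b - a); pose g t := a + t *: (b - a).
have gD s t : enorm (g s - g t) = `|s - t| * D.
  by rewrite /g opprD addrACA subrr add0r -scalerBl enormZ.
have D0 : 0 <= D by exact: enorm_ge0.
have step t : exists2 d : R, 0 < d & forall s, `|s - t| < d ->
    enorm (theta (g s) - theta (g t)) = `|s - t| * D.
  have [d d0 hd] := loc (g t); exists (d / (D + 1)); first by rewrite divr_gt0//; lra.
  move=> s st; rewrite hd gD//.
  rewrite ltr_pdivlMr in st; last lra.
  apply: le_lt_trans st; rewrite ler_wpM2l//; lra.
suff : enorm (theta a - theta (g 1)) <= 1 * D.
  by rewrite mul1r /D (enormC b) /g scale1r (addrC a) subrK.
apply: (real_induction (S := fun t => enorm (theta a - theta (g t)) <= t * D)) => //.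
- by rewrite /g scale0r addr0 subrr enorm0 mul0r.
- move=> t t0 IH; have [d d0 hd] := step t; exists d => // s /andP[s1 s2].
  apply: le_trans (enorm_tri (theta (g t)) _ _) _.
  have := IH t; rewrite t0 lexx => /(_ isT).
  by rewrite (enormC (theta (g t))) hd ger0_norm ?subr_ge0//; lra.
- move=> t t0 IH; have [d d0 hd] := step t; pose s := Num.max 0 (t - d / 2).
  have s1 : 0 <= s by rewrite le_max lexx.
  have s2 : s < t by rewrite gt_max t0/=; lra.
  have s3 : t - d / 2 <= s by rewrite le_max lexx orbT.
  apply: le_trans (enorm_tri (theta (g s)) _ _) _.
  have := IH s; rewrite s1 s2 => /(_ isT).
  by rewrite hd ltr0_norm ?subr_lt0//; lra.
Qed.

(** When [c] lies in a chamber, [v] is the image of [q] under the retraction onto the apartment of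
    [f] centred at that chamber, read in the coordinates of [f]. *)
Lemma retraction_ex f c (q : X) : A f ->
  exists k v, [/\ A k, forall z, face H c z -> k z = f z & k v = q].
Proof.
move=> Af; have [k [Ak kc [v _ kv]]] := atlas_pair BA (f c) q.
have [k' [Ak' E Ek]] := chart_normalize HW BA Af Ak kc.
have [v' _ kv'] : range k' q by rewrite E; exists v.
by exists k', v'.
Qed.

Lemma retraction_unique f c k1 k2 v1 v2 : A k1 -> A k2 -> in_chamber H c ->
  (forall z, face H c z -> k1 z = f z) -> (forall z, face H c z -> k2 z = f z) ->
  k1 v1 = k2 v2 -> v1 = v2.
Proof.
move=> A1 A2 Hc E1 E2 E.
have [||w [_ iw Ew]] := chart_change HW BA A1 A2 (u := c) (v := v1).
- by exists c; rewrite // E1// E2.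
- by exists v2.
have i2 := isometric_inj (chart_isometric BA A2).
have w1 : w =1 id.
  apply: (wall_isometry_eq HW iw wall_isometry_id Hc) => y cy.
  by apply: i2; rewrite Ew ?E1 ?E2//; left.
by apply: i2; rewrite -E -Ew ?w1//; right.
Qed.

(* The retraction centred at the chamber [f c] is an isometry on every chamber, hence contracts. *)
Lemma retraction_contracts f c k1 k2 v1 v2 : A f -> A k1 -> A k2 -> in_chamber H c ->
  (forall z, face H c z -> k1 z = f z) -> (forall z, face H c z -> k2 z = f z) ->
  enorm (v1 - v2) <= mdist (k1 v1) (k2 v2).
Proof.
move=> Af A1 A2 Hc E1 E2.
have [m [Am [a _ ma] [b _ mb]]] := atlas_pair BA (k1 v1) (k2 v2).
(* [theta] is the retraction read from the chart [m] through both points to the chart [f]. *)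
have /choice[theta th] : forall v, exists v', exists2 k, A k &
    (forall z, face H c z -> k z = f z) /\ k v' = m v.
  move=> v; have [k [v' [Ak Ek kv]]] := retraction_ex c (m v) Af.
  by exists v', k.
have thE k v v' : A k -> (forall z, face H c z -> k z = f z) -> k v' = m v -> theta v = v'.
  move=> Ak Ek kv; have [k' Ak' [Ek' kv']] := th v.
  by apply: (retraction_unique Ak' Ak Hc Ek' Ek); rewrite kv' kv.
rewrite -ma -mb (chart_isometric BA Am) -(thE k1 a v1)// -(thE k2 b v2)//.
apply: local_isometry_lipschitz => v.
have [d d0 hd] := face_le_near HW v; exists d => // v' /hd vv'.
(* Both [v] and the nearby [v'] are in the closure of this one chamber, on which [theta] coincides
   with the wall isometry [w]. *)
have [c' [_ Hc' v'c']] := chamber_near HW v' ltr01.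
have vc' := face_le_trans vv' v'c'.
have [k [u [Ak Ek ku]]] := retraction_ex c (m c') Af.
have [||w [_ iw Ew]] := chart_change HW BA Am Ak (u := c') (v := c').
- by exists u.
- by exists u.
have close y : face_le H y c' -> k (w y) = m y.
  move=> yc'; apply: (agree_closure (F1 := k \o w) _ _ yc') => [x z||z c'z].
  - by rewrite (chart_isometric BA Ak) (wall_isometry_iso iw).
  - exact: (chart_isometric BA Am).
  - by apply: Ew; left.
by rewrite (thE k v (w v))// ?close// (thE k v' (w v'))// ?close// (wall_isometry_iso iw).
Qed.

(* The CN inequality of Bruhat and Tits along the affine segments of [F]. *)
Definition CN F := forall (q : X) x y s, 0 <= s <= 1 ->
  mdist q (F (x + s *: (y - x))) ^+ 2 <=
  (1 - s) * mdist q (F x) ^+ 2 + s * mdist q (F y) ^+ 2 -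
  s * (1 - s) * enorm (y - x) ^+ 2.

(* Retract onto the apartment from a chamber having the point [z] of the segment in its closure:
   distances to [f z] are preserved and the others do not increase. *)
Lemma chart_CN f : A f -> CN f.
Proof.
move=> Af q x y s /andP[s0 s1]; set z := x + _.
have [c [_ Hc zc]] := chamber_near HW z ltr01.
have [k [v [Ak Ek kv]]] := retraction_ex c q Af.
have -> : f z = k z.
  by apply: (agree_closure (chart_isometric BA Af) (chart_isometric BA Ak) zc) => u /Ek.
have le u : enorm (v - u) ^+ 2 <= mdist q (f u) ^+ 2.
  rewrite lerXn2r ?nnegrE ?enorm_ge0 ?mdist_ge0// -kv.
  exact: (retraction_contracts _ _ Af Ak Af Hc Ek).
have := le x; have := le y.
rewrite -{3}kv (chart_isometric BA Ak) !sqr_enorm.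
have -> : dot (v - z) (v - z) = (1 - s) * dot (v - x) (v - x) +
   s * dot (v - y) (v - y) - s * (1 - s) * dot (y - x) (y - x).
  rewrite /z !dot_linear (dotC x v) (dotC y v) (dotC y x); ring.
nra.
Qed.

Lemma twisted_CN F : twisted_chart (H := H) (A := A) F -> CN F.
Proof.
move=> [f [phi [Af [Q [b [QQ Ep _]]] E]]] q x y s s01.
have -> : F (x + s *: (y - x)) = f (phi x + s *: (phi y - phi x)).
  rewrite E; congr f; rewrite !Ep mulmxDl -scalemxAl mulmxBl.
  by rewrite opprD (addrACA _ b) subrr addr0 addrAC.
have -> : enorm (y - x) = enorm (phi y - phi x).
  by rewrite !Ep opprD addrACA subrr addr0 -mulmxBl orthogonal_enorm.
by rewrite !E; apply: chart_CN.
Qed.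

(** The two bounds make the right-hand side of [CN] at most 0. This is uniqueness of geodesics in a
    form that recognises a point of [X] by its distances to two points of a chart. *)
Lemma CN_unique F (q : X) x y s : CN F -> 0 <= s <= 1 ->
  mdist q (F x) <= s * enorm (y - x) -> mdist q (F y) <= (1 - s) * enorm (y - x) ->
  q = F (x + s *: (y - x)).
Proof.
move=> cn s01 qx qy; have /andP[s0 s1] := s01; apply: mdist_positivity.
have := cn q x y s s01; move: (mdist q _) (mdist_ge0 q (F (x + s *: (y - x)))) => D D0.
have := mdist_ge0 q (F x); have := mdist_ge0 q (F y).
move: (mdist q (F x)) (mdist q (F y)) (enorm (y - x)) qx qy => a b m am bm b0 a0 h.
have a2 : a ^+ 2 <= (s * m) ^+ 2 by rewrite lerXn2r// nnegrE// (le_trans a0).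
have b2 : b ^+ 2 <= ((1 - s) * m) ^+ 2 by rewrite lerXn2r// nnegrE// (le_trans b0).
apply/eqP; rewrite -sqrf_eq0 eq_le sqr_ge0 andbT.
have a3 := ler_wpM2l (_ : 0 <= 1 - s) a2; have b3 := ler_wpM2l s0 b2.
have {}a3 := a3 ltac:(lra).
apply: le_trans h _.
have -> : 0 = (1 - s) * (s * m) ^+ 2 + s * ((1 - s) * m) ^+ 2 - s * (1 - s) * m ^+ 2 by ring.
lra.
Qed.

(** Let [d] and [D] be the distances from [p] to the ends of the long segment and [m] its length.
    [CN] at the ratio [e / s] simplifies to [(d + m)^2 <= D^2], and the triangle inequality gives
    the converse. *)
Lemma CN_extend F (p : X) z T (e s : R) : CN F -> isometric F -> 0 < e <= s ->
  mdist p (F (z + e *: T)) = mdist p (F z) + e * enorm T ->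
  mdist p (F (z + s *: T)) = mdist p (F z) + s * enorm T.
Proof.
move=> cn iF /andP[e0 es] E; have s0 := lt_le_trans e0 es.
have up : mdist p (F (z + s *: T)) <= mdist p (F z) + s * enorm T.
  apply: le_trans (metric_triangle _ (F z) _) _.
  by rewrite iF opprD addrA subrr sub0r enormN enormZ gtr0_norm.
apply/eqP; rewrite eq_le up/=.
pose r := e / s; have r0 : 0 < r by rewrite divr_gt0.
have r1 : r <= 1 by rewrite ler_pdivrMr// mul1r.
have := cn p z (z + s *: T) r; rewrite (ltW r0) r1 => /(_ isT).
rewrite [z + _ - z]addrC addKr scalerA mulfVK ?gt_eqF// E.
rewrite enormZ (gtr0_norm s0).
have -> : e * enorm T = r * (s * enorm T) by rewrite mulrA mulfVK ?gt_eqF.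
move: (s * enorm T) (mulr_ge0 (ltW s0) (enorm_ge0 T)) => m m0.
have := mdist_ge0 p (F z); have := mdist_ge0 p (F (z + s *: T)).
move: (mdist p (F z)) (mdist p _) => d D D0 d0 h.
rewrite -(ler_pXn2r (n:=2))// ?nnegrE ?addr_ge0//.
by rewrite -(ler_pM2l r0); nra.
Qed.

(* [g] matches the germ of the segment [F z, F (z + T)] at [F z] with its continuation at
   [F (z + T)], so the translates form a local geodesic, and [CN_extend] makes it a geodesic. *)
Lemma iter_mdist (g g' : X -> X) F z T (e : R) : CN F -> isometric F ->
  (forall x y : X, mdist (g x) (g y) = mdist x y) -> cancel g' g ->
  0 < e <= 1 -> g (F z) = F (z + T) -> g (F (z + e *: T)) = F (z + e *: T + T) ->
  forall N, mdist (iter N g' (F z)) (F z) = N%:R * enorm T.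
Proof.
move=> cn iF ig K e01 gz gze N.
have ig' (x y : X) : mdist (g' x) y = mdist x (g y) by rewrite -ig K.
suff [] : mdist (iter N g' (F z)) (F z) = N%:R * enorm T /\
  mdist (iter N g' (F z)) (F (z + e *: T)) =
  mdist (iter N g' (F z)) (F z) + e * enorm T by [].
have /andP[e0 e1] := e01.
elim: N => [|N [IH1 IH2]] /=.
  rewrite mdistxx mul0r add0r iF opprD addrA subrr sub0r enormN enormZ.
  by rewrite gtr0_norm.
rewrite !ig' gz gze.
have h1 := CN_extend cn iF e01 IH2; rewrite scale1r in h1.
have e' : 0 < e <= e + 1 by rewrite e0/=; lra.
have := CN_extend cn iF e' IH2; rewrite scalerDl scale1r addrA => ->.
by rewrite h1 IH1 -natr1; split; ring.
Qed.

End NonPositiveCurvature.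

(** * Recurrence of charts *)

Section Pigeonhole.

Lemma infinite_pigeonhole (S T : Type) (J : set S) (D : set T) (f : S -> T) :
  finite_set D -> infinite_set J -> (forall i, J i -> D (f i)) ->
  exists2 t, D t & infinite_set [set i | J i /\ f i = t].
Proof.
move=> finD infJ JD; apply: contrapT => h; apply: infJ.
apply: (@sub_finite_set _ _ (\bigcup_(t in D) [set i | J i /\ f i = t])).
  by move=> i Ji; exists (f i); [exact: JD|].
apply: bigcup_finite => // t Dt; apply: contrapT => ht; apply: h.
by exists t.
Qed.

Lemma infinite_two (S : Type) (J : set S) : infinite_set J ->
  exists i j, [/\ J i, J j & i <> j].
Proof.
move=> infJ; have [i Ji] := infinite_setN0 infJ.
have [j [Jj ij]] := infinite_setN0 (infinite_setD infJ (finite_set1 i)).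
by exists i, j; split => // E; apply: ij.
Qed.

Lemma infinite_natP (J : set nat) :
  infinite_set J <-> forall N, exists2 i, (N <= i)%N & J i.
Proof.
split=> [infJ N|h].
  have [i [Ji iN]] := infinite_setN0 (infinite_setD infJ (finite_II N)).
  by exists i => //; rewrite leqNgt; apply/negP.
move=> /finite_seqP[s E]; have [i si Ji] := h (\max_(j <- s) j).+1.
have : [set` s] i by rewrite -E.
by move=> /= /(@leq_bigmax_seq _ s xpredT (fun j : nat => j) i)/(_ isT); rewrite leqNgt si.
Qed.

Lemma compact_sequence (R : realType) (X : metricType R) (K : set X) (x : nat -> X) :
  compact K -> (forall i, K (x i)) -> exists y, forall r : R, 0 < r ->
    infinite_set [set i | mdist (x i) y < r].
Proof.
move=> cK Kx; have [|y [_ hy]] := cK (x @ \oo); first by exists 0%N => // i _; exact: Kx.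
exists y => r r0; apply/infinite_natP => N.
have By : nbhs y (ball y r) by apply: nbhsx_ballx.
have hN : (x @ \oo) (x @` [set i | (N <= i)%N]).
  by exists N => // i /= Ni; exists i.
have [_ [[i /= Ni <-] yi]] := hy _ _ hN By.
by exists i => //; move: yi; rewrite ballEmdist /= metric_sym.
Qed.

End Pigeonhole.

(** * Finite colourings of bounded sets *)

Section Coloring.
Context {R : realType} {n : nat}.

Lemma enorm_sum (x : 'rV[R]_n) : enorm x <= \sum_i `|x 0 i|.
Proof.
rewrite {1}[x]row_sum_delta; elim/big_ind2 : _ => [|x1 y1 x2 y2 h1 h2|i _].
- by rewrite enorm0.
- by apply: le_trans (enormD _ _) _; apply: lerD.
- by rewrite enormZ enorm_delta mulr1.
Qed.

Lemma bounded_coloring (B eta : R) : 0 < eta ->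
  exists (N : nat) (col : 'rV[R]_n -> {ffun 'I_n -> 'I_N.+1}),
  forall x y, enorm x <= B -> enorm y <= B -> col x = col y -> enorm (x - y) < eta.
Proof.
(* A grid of mesh [e] is used. Dividing by [n.+1] makes the sum of [n] coordinate errors strictly
   smaller than [eta]. *)
move=> eta0; pose e := eta / n.+1%:R; have e0 : 0 < e by rewrite divr_gt0.
pose t (x : 'rV[R]_n) i := Num.truncn ((x 0 i + B) / e).
pose N := Num.truncn ((B + B) / e).
(* [inord] is faithful on the ball of radius [B], where the grid indices are at most [N]; outside it
   the colour carries no information. *)
exists N, (fun x => [ffun i => inord (t x i)]) => x y xB yB E.
have nonneg (z : 'rV[R]_n) i : enorm z <= B -> 0 <= (z 0 i + B) / e.
  move=> zB; rewrite divr_ge0 ?(ltW e0)//.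
  have := le_trans (enorm_coord z i) zB; rewrite ler_norml => /andP[+ _].
  by rewrite -subr_ge0 opprK.
have tN (z : 'rV[R]_n) i : enorm z <= B -> (t z i < N.+1)%N.
  move=> zB; rewrite ltnS; apply: le_truncn; rewrite ler_pM2r ?invr_gt0// lerD2r.
  by apply: le_trans (ler_norm _) (le_trans (enorm_coord z i) zB).
have coord i : `|(x - y) 0 i| <= e.
  have : t x i = t y i.
    have := congr1 (fun c : {ffun 'I_n -> 'I_N.+1} => nat_of_ord (c i)) E.
    by rewrite !ffunE !inordK ?tN.
  rewrite /t => txy; have := truncn_itv (nonneg x i xB); have := truncn_itv (nonneg y i yB).
  rewrite -txy; move: (Num.truncn _) => k /andP[y1 y2] /andP[x1 x2].
  clear E; clearbody e; rewrite !mxE ler_norml; move: y1 y2 x1 x2.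
  rewrite !ler_pdivlMr// !ltr_pdivrMr// -natr1 mulrDl mul1r => y1 y2 x1 x2.
  by apply/andP; split; lra.
apply: le_lt_trans (enorm_sum _) _.
apply: (@le_lt_trans _ _ (\sum_(i < n) e)); first exact: ler_sum.
rewrite sumr_const card_ord -[_ *+ n]mulr_natr /e -mulrA gtr_pMr//.
by rewrite mulrC ltr_pdivrMr// mul1r ltr_nat.
Qed.

Lemma separated_finite (S : set 'rV[R]_n) (B eta : R) : 0 < eta ->
  (forall x, S x -> enorm x <= B) ->
  (forall x y, S x -> S y -> enorm (x - y) < eta -> x = y) -> finite_set S.
Proof.
move=> eta0 SB sep; apply: contrapT => infS.
have [N [col hcol]] := bounded_coloring B eta0.
have [t _ inft] := infinite_pigeonhole (f := col) (@finite_finset _ setT) infS (fun _ _ => I).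
have [x [y [[Sx cx] [Sy cy] xy]]] := infinite_two inft.
by apply: xy; apply: sep => //; apply: hcol; rewrite ?cx ?cy//; apply: SB.
Qed.

End Coloring.

(** * Consequences of cocompactness and local finiteness *)

Section Cocompact.
Context {R : realType} {n : nat} {H : set (set 'rV[R]_n)}.
Context (HW : euclidean_walls H).
Context {X : metricType R} {A : set ('rV[R]_n -> X)}.
Context (BA : building_atlas H A) (CA : complete_atlas H A).
Context (LF : locally_finite H A).
Context {G : groupType} {act : G -> X -> X}.
Context (act_aut : acts_by_automorphisms H A act) (act_cocompact : cocompact act).
Implicit Types (x y z u v c : 'rV[R]_n) (phi psi w : 'rV[R]_n -> 'rV[R]_n).
Implicit Types (f k F P : 'rV[R]_n -> X).
Local Notation wall_isometry := (wall_isometry (H := H)).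
Local Notation twisted_chart := (twisted_chart (H := H) (A := A)).

Lemma act_isometric g (x y : X) : mdist (act g x) (act g y) = mdist x y.
Proof. exact: (automorphism_isometric (act_automorphism act_aut g)). Qed.

Lemma actK g : cancel (act g) (act g^-1%g).
Proof. by move=> x; rewrite -(act_mul act_aut) mulVg (act_one act_aut). Qed.

Lemma actVK g : cancel (act g^-1%g) (act g).
Proof. by move=> x; rewrite -(act_mul act_aut) mulgV (act_one act_aut). Qed.

Lemma act_twisted g f : A f -> twisted_chart (act g \o f).
Proof.
apply: (automorphism_twisted HW BA CA _ _ (actK g) (actVK g));
  exact: act_automorphism.
Qed.

Lemma image_face phi c : wall_isometry phi -> phi @` face H c = face H (phi c).
Proof.
move=> hphi; apply/seteqP; split => [_ [z cz <-]|y]; first by rewrite wall_isometry_face.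
have [psi [hpsi K K']] := wall_isometry_inv hphi.
by rewrite -{1}(K' y) wall_isometry_face// => cy; exists (psi y).
Qed.

(** A chart through [y] and the chamber can be normalised to place [y] at [w0]. A point close to
    [w0] lies in a face above that of [w0], so the chamber has the simplex of [y] as a face, and
    local finiteness applies to that simplex. *)
Lemma local_chambers (y : X) : exists (r : R) (T : set (set X)) (w0 : 'rV[R]_n),
  [/\ 0 < r <= 1, finite_set T & forall P x c, twisted_chart P -> in_chamber H c ->
    face_le H x c -> mdist (P x) y < r -> T (P @` face H c) /\
    exists k d, [/\ A k, k w0 = y, in_chamber H d & k @` face H d = P @` face H c]].
Proof.
have [k0 [Ak0 [w0 _ kw0] _]] := atlas_pair BA y y.
have [d d0 hd] := face_le_near HW w0.
exists (Num.min 1 d), [set t | simplex_le H A (k0 @` face H w0) t], w0; split.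
- by rewrite lt_min ltr01 d0 ge_min lexx.
- by apply: LF; exists k0, w0.
move=> P x c tP Hc xc; rewrite lt_min => /andP[_ Py].
have [k [Ak [w1 _ kw1] [c1 _ kc1]]] := atlas_pair BA y (P c).
have kk0 : range k (k0 w0) by exists w1; rewrite // kw1 kw0.
have [k' [Ak' Erange Ek']] := chart_normalize HW BA Ak0 Ak kk0.
have kPc : range k' (P c) by rewrite Erange; exists c1.
have [phi [hphi Ephi]] := twisted_change HW BA tP (chart_twisted Ak') kPc kPc.
have tk := twisted_comp (chart_twisted Ak') hphi.
have Ex : k' (phi x) = P x.
  apply: (agree_closure (twisted_isometric BA tk) (twisted_isometric BA tP) xc) => z cz.
  by apply: Ephi; left.
have Ek0 : k' w0 = y by rewrite Ek' ?kw0.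
have w0c : face_le H w0 (phi c).
  apply: (@face_le_trans _ _ H _ (phi x)); last by rewrite wall_isometry_face_le.
  by apply: hd; rewrite -(chart_isometric BA Ak') Ex Ek0.
have Ec : k' @` face H (phi c) = P @` face H c.
  rewrite -image_face// image_comp; apply/seteqP; split => _ [z cz <-].
    by exists z => //; rewrite -Ephi//; left.
  by exists z => //=; rewrite Ephi//; left.
split; last by exists k', (phi c); split => //; rewrite wall_isometry_chamber.
exists k', w0, (phi c); split => //.
by apply/seteqP; split => _ [z hz <-]; exists z => //; rewrite Ek'.
Qed.

(** The group moves the points [f i (x i)] into a compact set, and near a cluster point only
    finitely many chambers are available, so infinitely many indices share one. The map [phi] reads
    the moved chart in the fixed chart [e]; keeping [phi (x i)] within 1 of [w0] confines later
    counting to a ball of R^n. *)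
Lemma chart_recurrence (f : nat -> 'rV[R]_n -> X) (x c : nat -> 'rV[R]_n) :
  (forall i, A (f i)) -> (forall i, in_chamber H (c i)) ->
  (forall i, face_le H (x i) (c i)) ->
  exists e d (w0 : 'rV[R]_n), [/\ A e, in_chamber H d &
    infinite_set [set i | exists g phi, [/\ wall_isometry phi,
      forall z, face H (c i) z -> act g (f i z) = e (phi z),
      face H d (phi (c i)) & enorm (phi (x i) - w0) < 1]]].
Proof.
move=> Af Hc xc; have [K [cK hK]] := act_cocompact.
have /choice[h hKx] : forall i, exists h, K (act h (f i (x i))).
  move=> i; have [g [y [Ky E]]] := hK (f i (x i)); exists g^-1%g.
  by rewrite E actK.
have [y hy] := compact_sequence cK hKx.
have [r [T [w0 [/andP[r0 r1] finT hT]]]] := local_chambers y.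
pose P i := act (h i) \o f i.
have tP i : twisted_chart (P i) by apply: act_twisted.
have [t Tt inft] : exists2 t, T t & infinite_set
    [set i | mdist (P i (x i)) y < r /\ P i @` face H (c i) = t].
  apply: infinite_pigeonhole finT (hy r r0) _ => i /= hi.
  by have [] := hT _ _ _ (tP i) (Hc i) (xc i) hi.
have [i0 [hi0 Ei0]] := infinite_setN0 inft.
have [_ [k [d [Ak kw0 Hd Ekd]]]] := hT _ _ _ (tP i0) (Hc i0) (xc i0) hi0.
exists k, d, w0; split => //; apply: sub_infinite_set inft => i [hi Ei].
have Ed : P i @` face H (c i) = k @` face H d by rewrite Ei Ekd Ei0.
have [v dv kv] : (k @` face H d) (P i (c i)) by rewrite -Ed; exists (c i).
have kPc : range k (P i (c i)) by exists v.
have [phi [hphi Ephi]] := twisted_change HW BA (tP i) (chart_twisted Ak) kPc kPc.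
have kphi z : face H (c i) z -> k (phi z) = P i z by move=> cz; apply: Ephi; left.
have tk := twisted_comp (chart_twisted Ak) hphi.
have Ex : k (phi (x i)) = P i (x i).
  exact: (agree_closure (twisted_isometric BA tk) (twisted_isometric BA (tP i)) (xc i)).
exists (h i), phi; split => //.
- by move=> z /kphi.
- suff -> : phi (c i) = v by [].
  by apply: (isometric_inj (chart_isometric BA Ak)); rewrite kphi.
- by rewrite -(chart_isometric BA Ak) Ex kw0; apply: lt_le_trans r1.
Qed.

(* Otherwise [chart_recurrence] would bring points lying on arbitrarily many walls into a fixed
   ball of the model apartment. *)
Lemma walls_through_bounded : exists M : nat, forall x (s : 'I_M.+1 -> set 'rV[R]_n),
  injective s -> (forall i, H (s i) /\ s i x) -> False.
Proof.
apply: contrapT => nM.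
have /choice[x hx] : forall M : nat, exists x, exists s : 'I_M.+1 -> set 'rV[R]_n,
    injective s /\ forall i, H (s i) /\ s i x.
  move=> M; apply: contrapT => h; apply: nM; exists M => x s inj hs; apply: h.
  by exists x, s.
have [f Af] := chart_exists BA.
have /choice[c hc] : forall i, exists c, in_chamber H c /\ face_le H (x i) c.
  by move=> i; have [c [_ Hc xc]] := chamber_near HW (x i) ltr01; exists c.
have [e [d [w0 [Ae Hd infJ]]]] := chart_recurrence (fun=> Af) (fun i => (hc i).1) (fun i => (hc i).2).
have /finite_seqP[q Eq] := walls_locally_finite HW w0 1.
have [i qi [g [phi [hphi _ _ xw0]]]] := (infinite_natP _).1 infJ (size q).
have [s [inj hs]] := hx i.
have [Q [b [QQ Ephi HQ]]] := hphi.
have imH h : H h -> H (phi @` h).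
  move=> Hh; have [a [k [_ E]]] := walls_hyperplane HW Hh; rewrite E in Hh *.
  by rewrite (image_hyperplane _ _ QQ Ephi) HQ.
have [psi [_ K _]] := wall_isometry_inv hphi.
have imK : cancel (fun h : set 'rV[R]_n => phi @` h) (fun h => psi @` h).
  by move=> h; rewrite image_comp (_ : psi \o phi = id) ?image_id//; apply/funext.
have : (size [seq phi @` s j | j <- enum 'I_i.+1] <= size q)%N.
  apply: uniq_leq_size.
    rewrite map_inj_uniq ?enum_uniq// => j1 j2 /(can_inj imK); exact: inj.
  move=> _ /mapP[j _ ->]; suff : [set` q] (phi @` s j) by [].
  have [Hs sx] := hs j; rewrite -Eq; split; first exact: imH.
  by exists (phi (x i)); [exists (x i)|exact: ltW].
by rewrite size_map size_enum_ord ltnNge qi.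
Qed.

End Cocompact.

(** * Linear walls *)

Section Lists.
Context {R : realType} {T : eqType}.

Lemma seq_argmin (f : T -> R) (s : seq T) x0 : x0 \in s ->
  exists2 x, x \in s & forall y, y \in s -> f x <= f y.
Proof.
elim: s x0 => // a s IH x0 _; case: s IH => [|b s] IH.
  by exists a; rewrite ?mem_head// => y; rewrite inE => /eqP->.
have [x xs hx] := IH b (mem_head _ _); have [ax|/ltW xa] := leP (f a) (f x).
  exists a; rewrite ?mem_head// => y; rewrite inE => /predU1P[->//|/hx].
  exact: le_trans.
exists x; first by rewrite inE xs orbT.
by move=> y; rewrite inE => /predU1P[->//|/hx].
Qed.

(** For constant [g = 1] this is a lower bound of the positive values of [f]. In general
    [f x + k * g x] stays nonnegative for [|k| <= e]. *)
Lemma seq_pos_bound (f g : T -> R) (s : seq T) : exists2 e : R, 0 < e &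
  forall x, x \in s -> 0 < f x -> e * `|g x| <= f x.
Proof.
elim: s => [|a s [e e0 he]]; first by exists 1.
have [fa|fa] := leP (f a) 0.
  exists e => // x; rewrite inE => /predU1P[->|/he//].
  by rewrite ltNge fa.
have g1 : 0 < `|g a| + 1 by rewrite ltr_wpDl.
exists (Num.min e (f a / (`|g a| + 1))); first by rewrite lt_min e0 divr_gt0.
move=> x; rewrite inE => /predU1P[-> _|/he hx /hx].
  apply: (@le_trans _ _ (f a / (`|g a| + 1) * `|g a|)).
    by rewrite ler_wpM2r// ge_min lexx orbT.
  rewrite -mulrA ger_pMr// mulrC ler_pdivrMr// mul1r lerDl//.
by apply: le_trans; rewrite ler_wpM2r// ge_min lexx.
Qed.

End Lists.

(** * Normals of walls as a root system *)

Section Roots.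
Context {R : realType} {n : nat} {H : set (set 'rV[R]_n)}.
Context (HW : euclidean_walls H).
Implicit Types (x y z u v a b p q : 'rV[R]_n).

(** The roots of the linear reflection group, normalised to length 1; every wall direction
    contributes both [a] and [- a]. *)
Definition unit_normal a := enorm a = 1 /\ exists c, H (hyperplane a c).

Lemma unit_normal_dot a : unit_normal a -> dot a a = 1.
Proof. by move=> [a1 _]; rewrite -sqr_enorm a1 expr1n. Qed.

Lemma unit_normal_neq0 a : unit_normal a -> a != 0.
Proof. by move=> /unit_normal_dot aa; rewrite -dotxx_eq0 aa oner_eq0. Qed.

Lemma hyperplaneZ (k : R) a c : k != 0 -> hyperplane (k *: a) (k * c) = hyperplane a c.
Proof.
by move=> k0; apply/seteqP; split => x; rewrite /hyperplane/= dotZl; [move/(mulfI k0)|move=> ->].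
Qed.

Lemma wall_unit_normal b c : H (hyperplane b c) -> exists2 a, unit_normal a & b = enorm b *: a.
Proof.
move=> Hbc; have b0 := wall_normal_neq0 HW Hbc.
have eb : 0 < enorm b by rewrite enorm_gt0.
have E : b = enorm b *: ((enorm b)^-1 *: b) by rewrite scalerA divff ?gt_eqF// scale1r.
exists ((enorm b)^-1 *: b) => //; split.
  by rewrite enormZ gtr0_norm ?invr_gt0// mulVf// gt_eqF.
exists ((enorm b)^-1 * c); rewrite hyperplaneZ// invr_eq0 gt_eqF//.
Qed.

Lemma unit_normalN a : unit_normal a -> unit_normal (- a).
Proof.
move=> [a1 [c Hc]]; split; first by rewrite enormN.
by exists (- c); rewrite -scaleN1r -[- c]mulN1r hyperplaneZ// oppr_eq0 oner_eq0.
Qed.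

(** Adding the component of [b] orthogonal to [a] does not leave the hyperplane, so this component
    is orthogonal to [b] too, and therefore 0. *)
Lemma hyperplane_inj a b (c d : R) : enorm a = 1 -> enorm b = 1 ->
  hyperplane a c = hyperplane b d -> a = b \/ a = - b.
Proof.
move=> a1 b1 E.
have aa : dot a a = 1 by rewrite -sqr_enorm a1 expr1n.
have bb : dot b b = 1 by rewrite -sqr_enorm b1 expr1n.
have h1 : hyperplane b d (c *: a) by rewrite -E /hyperplane/= dotZr aa mulr1.
have h2 : hyperplane b d (c *: a + (b - dot a b *: a)).
  by rewrite -E /hyperplane/= !dot_linear aa; ring.
have h3 : dot b (b - dot a b *: a) = 0.
  by apply: (addrI (dot b (c *: a))); rewrite -dotDr addr0 (h1 : dot b _ = d).
have l2 : dot a b ^+ 2 = 1.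
  by move: h3; rewrite !dot_linear bb (dotC b a) expr2; lra.
have bE : b = dot a b *: a.
  apply/eqP; rewrite -subr_eq0 -dotxx_eq0; apply/eqP.
  by rewrite !dot_linear (dotC b a) aa bb; move: l2; rewrite expr2; lra.
have : (dot a b == 1) || (dot a b == -1) by rewrite -sqrf_eq1 l2.
by move=> /orP[/eqP l|/eqP l]; [left|right]; rewrite bE l ?scale1r// scaleN1r opprK.
Qed.

Lemma image_reflection_hyperplane a b c d : a != 0 ->
  reflection a c @` hyperplane b d =
  hyperplane (b - (2 * dot a b / dot a a) *: a) (d - 2 * dot a b / dot a a * c).
Proof.
move=> a0; have aa : dot a a != 0 by rewrite dotxx_eq0.
have E y : dot b (reflection a c y) - d =
  dot (b - (2 * dot a b / dot a a) *: a) y - (d - 2 * dot a b / dot a a * c).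
  by rewrite /reflection !dot_linear (dotC b a); field.
apply/seteqP; split => [_ [y + <-]|y]; rewrite /hyperplane/= => hy.
  by apply/eqP; rewrite -subr_eq0 -E reflectionK// hy subrr.
exists (reflection a c y); last exact: reflectionK.
by apply/eqP; rewrite -subr_eq0 E hy subrr.
Qed.

Lemma unit_normal_reflection a b : unit_normal a -> unit_normal b -> unit_normal (b - (2 * dot a b) *: a).
Proof.
move=> /[dup] ra [a1 [c Hc]] /[dup] rb [b1 [d Hd]]; have aa := unit_normal_dot ra; have bb := unit_normal_dot rb; split.
  have E : dot (b - (2 * dot a b) *: a) (b - (2 * dot a b) *: a) = 1.
    by rewrite !dot_linear (dotC b a) aa bb; ring.
  by rewrite /enorm E sqrtr1.
exists (d - 2 * dot a b * c); have := walls_reflection HW Hc Hd.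
by rewrite image_reflection_hyperplane ?unit_normal_neq0// aa divr1.
Qed.

Context (M : nat) (HM : forall x (s : 'I_M.+1 -> set 'rV[R]_n),
  injective s -> (forall i, H (s i) /\ s i x) -> False).

(* If [a] and [b] were closer, the normals [x_k] obtained by iterating the rotation of the
   dihedral group of [a] and [b] would give [M + 1] walls through a common point: [x_k]
   satisfies the Chebyshev recursion, and [dot a x_k] decreases while it is positive. *)
Lemma unit_normals_angle a b : unit_normal a -> unit_normal b -> dot a b < 1 ->
  1 <= M.+1%:R ^+ 2 * (1 - dot a b).
Proof.
move=> ra rb; set t := dot a b => t1; rewrite leNgt; apply/negP => small.
have [a1 [c Hc]] := ra; have [b1 [d Hd]] := rb.
have aa := unit_normal_dot ra; have bb := unit_normal_dot rb.
pose e := 1 - t; have e0 : 0 < e by rewrite subr_gt0.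
rewrite -/e in small.
have K1 : 1 <= M.+1%:R ^+ 2 :> R by rewrite exprn_ege1// ler1n.
have t0 : 0 < t by move: small; rewrite /e; nra.
have tt : 1 - t ^+ 2 != 0 by rewrite gt_eqF//; nra.
(* A common point of the two walls, from the Gram matrix of [a] and [b], whose determinant is
   [1 - t ^+ 2]. *)
pose q := ((c - t * d) / (1 - t ^+ 2)) *: a + ((d - t * c) / (1 - t ^+ 2)) *: b.
have aq : dot a q = c by rewrite /q !dot_linear aa -/t; field.
have bq : dot b q = d by rewrite /q !dot_linear bb (dotC b a) -/t; field.
(* The new vector is minus the reflection of [xy.1] in the wall of [xy.2], so the walls through [q]
   reproduce themselves and the angle between neighbours stays the same. *)
pose step (xy : 'rV[R]_n * 'rV[R]_n) := (xy.2, (2 * t) *: xy.2 - xy.1).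
pose X k := iter k step (a, b).
pose x k := (X k).1; pose y k := dot a (x k).
have inv k : [/\ dot (X k).1 (X k).1 = 1, dot (X k).2 (X k).2 = 1,
    dot (X k).1 (X k).2 = t, H (hyperplane (X k).1 (dot (X k).1 q)) &
    H (hyperplane (X k).2 (dot (X k).2 q))].
  elim: k => [|k [h1 h2 h3 h4 h5]]; first by rewrite /= aa bb aq bq.
  rewrite /X iterS -/(X k); move: (X k) h1 h2 h3 h4 h5 => [u v] /= h1 h2 h3 h4 h5.
  split=> //.
  - by rewrite !dot_linear h1 h2 (dotC v u) h3; ring.
  - by rewrite !dot_linear h2 (dotC v u) h3; ring.
  - have := walls_reflection HW h5 h4.
    rewrite image_reflection_hyperplane; last by rewrite -dotxx_eq0 h2 oner_eq0.
    rewrite h2 divr1 (dotC v u) h3 -(hyperplaneZ _ _ (k := -1)) ?oppr_eq0 ?oner_eq0//.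
    rewrite scaleN1r mulN1r !opprB; congr (H (hyperplane _ _)).
    by rewrite !dot_linear.
have xrec k : x k.+2 = (2 * t) *: x k.+1 - x k by [].
have yrec k : y k.+2 = 2 * t * y k.+1 - y k by rewrite /y xrec !dot_linear.
(* If [t] is the cosine of an angle, [y k] is the cosine of [k] times that angle. These are the
   quadratic estimates of it with [e = 1 - t]; the assumption [small] keeps [y] positive, so that
   [x i] and [x j] are neither equal nor opposite. *)
have ineq k : (k <= M.+1)%N ->
  [/\ 1 - k%:R ^+ 2 * e <= y k, y k <= 1, e <= y k - y k.+1 &
   y k - y k.+1 <= (2 * k%:R + 1) * e].
  elim: k => [_|k IH kM].
    by rewrite /y /x /= aa -/t /e; split; nra.
  have [y1 y2 y3 y4] := IH (ltnW kM).
  have kK : k.+1%:R ^+ 2 * e <= M.+1%:R ^+ 2 * e.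
    by rewrite ler_wpM2r ?(ltW e0)// lerXn2r ?nnegrE// ler_nat.
  have k0 : 0 <= k%:R :> R by [].
  move: kK; rewrite yrec -[k.+1%:R]natr1 => kK.
  have y5 : 1 - (k%:R + 1) ^+ 2 * e <= y k.+1 by nra.
  have y6 : 0 < y k.+1 by move: small; lra.
  have y7 : y k.+1 <= 1 by lra.
  have et : 2 * t = 2 - 2 * e by rewrite /e; ring.
  split=> //; rewrite et; nra.
have ypos k : (k <= M)%N -> 0 < y k.
  move=> kM; have [y1 _ _ _] := ineq k (leqW kM).
  have : k%:R ^+ 2 * e <= M.+1%:R ^+ 2 * e.
    by rewrite ler_wpM2r ?(ltW e0)// lerXn2r ?nnegrE// ler_nat leqW.
  by move: small; lra.
have ydec i j : (i < j)%N -> (j <= M)%N -> y j < y i.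
  elim: j => // j IH; rewrite ltnS leq_eqVlt => /predU1P[->|ij] jM.
    by have [_ _ + _] := ineq j (leqW (ltnW jM)); lra.
  have := IH ij (ltnW jM); have [_ _ + _] := ineq j (leqW (ltnW jM)); lra.
apply: (HM (x := q) (s := fun i => hyperplane (x i) (dot (x i) q))); last first.
  by move=> i; have [_ _ _ h _] := inv i; split.
have wlog_ltn i j : (i < j)%N -> (j <= M)%N ->
    hyperplane (x i) (dot (x i) q) <> hyperplane (x j) (dot (x j) q).
  move=> ij jM; have unit k : enorm (x k) = 1.
    by have [h _ _ _ _] := inv k; rewrite /enorm h sqrtr1.
  have yij := ydec i j ij jM; have yi := ypos i (leq_trans (ltnW ij) jM); have yj := ypos j jM.
  move=> /(hyperplane_inj (unit i) (unit j))[E|E]; move: yij yi; rewrite /y E ?ltxx//.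
  by rewrite dotNr -/(y j); lra.
move=> i j E; apply/val_inj; case: (ltngtP (val i) (val j)) => // ij; exfalso.
  exact: (wlog_ltn _ _ ij (ltn_ord j) E).
exact: (wlog_ltn _ _ ij (ltn_ord i) (esym E)).
Qed.

Lemma unit_normals_separated : exists2 eta : R, 0 < eta &
  forall a b, unit_normal a -> unit_normal b -> enorm (a - b) < eta -> a = b.
Proof.
exists (M.+1%:R^-1) => [|a b ra rb ab]; first by rewrite invr_gt0.
have aa := unit_normal_dot ra; have bb := unit_normal_dot rb.
have E : enorm (a - b) ^+ 2 = 2 - 2 * dot a b.
  by rewrite sqr_enorm !dot_linear aa bb (dotC b a); ring.
have [t1|t1] := ltP (dot a b) 1.
  have := unit_normals_angle ra rb t1.
  have : enorm (a - b) ^+ 2 < (M.+1%:R^-1) ^+ 2.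
    by rewrite ltrXn2r ?nnegrE ?enorm_ge0 ?invr_ge0.
  rewrite E exprVn -[X in _ < X]div1r ltr_pdivlMr ?exprn_gt0// => h1 h2.
  have h3 : 0 <= M.+1%:R ^+ 2 * (1 - dot a b) by lra.
  by exfalso; move: h1; rewrite -[2 - _]/(2 - 2 * dot a b); nra.
apply/eqP; rewrite -subr_eq0 -enorm_eq0 -sqrf_eq0 eq_le sqr_ge0 andbT E; lra.
Qed.

Lemma finite_unit_normals : finite_set unit_normal.
Proof.
have [eta eta0 sep] := unit_normals_separated.
by apply: (separated_finite (B := 1) eta0) => [x [-> _]|].
Qed.

End Roots.

(** * Simple normals and faces of the model chamber *)

Section SimpleRoots.
Context {R : realType} {n : nat} {H : set (set 'rV[R]_n)}.
Context (HW : euclidean_walls H).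
Context (finR : finite_set (unit_normal (H := H))).
Context (p : 'rV[R]_n) (p_chamber : in_chamber (linear_walls H) p).
Implicit Types (x y z u v a b q : 'rV[R]_n).
Local Notation unit_normal := (unit_normal (H := H)).
Local Notation L := (linear_walls H).
Local Notation S := (chamber_walls L p).

Lemma unit_normal_linear_wall a : unit_normal a -> L (hyperplane a 0).
Proof. by move=> [_ [c Hc]]; exists a, c. Qed.

Lemma linear_wall_unit_normal b c : L (hyperplane b c) ->
  c = 0 /\ exists2 a, unit_normal a & b = enorm b *: a /\ b != 0.
Proof.
move=> [a [d [Had E]]]; have [a' ra' aE] := wall_unit_normal HW Had.
have b0 := hyperplane_eq_normal (wall_normal_neq0 HW Had) E.
have c0 : c = 0.
  have : hyperplane b c 0 by rewrite E /hyperplane/= dot0r.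
  by rewrite /hyperplane/= dot0r => ->.
split => //; have eb : 0 < enorm b by rewrite enorm_gt0.
pose b' := (enorm b)^-1 *: b.
have bE : b = enorm b *: b' by rewrite scalerA divff ?gt_eqF// scale1r.
have b'1 : enorm b' = 1.
  by rewrite enormZ gtr0_norm ?invr_gt0// mulVf// gt_eqF.
have a0 := wall_normal_neq0 HW Had.
have hba : hyperplane b' 0 = hyperplane a' 0.
  rewrite -(hyperplaneZ b' 0 (k := enorm b)) ?gt_eqF// -bE mulr0 -[in LHS]c0 E.
  by rewrite [in LHS]aE -[in LHS](mulr0 (enorm a)) hyperplaneZ// enorm_eq0.
have [a'1 _] := ra'; exists b' => //.
by have [->//|->] := hyperplane_inj b'1 a'1 hba; apply: unit_normalN.
Qed.

Lemma linear_wallP h : L h -> exists2 a, unit_normal a & h = hyperplane a 0 /\ 0 < dot a p.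
Proof.
move=> /[dup] Lh [b [c [Hbc E]]].
have [a ra bE] := wall_unit_normal HW Hbc.
have b0 : enorm b != 0 by rewrite enorm_eq0 (wall_normal_neq0 HW Hbc).
have ha : h = hyperplane a 0.
  by rewrite E [in LHS]bE -[in LHS](mulr0 (enorm b)) hyperplaneZ.
have ap : dot a p != 0.
  by apply/eqP => ap; apply: (p_chamber Lh); rewrite ha.
have [apos|aneg] := ltP 0 (dot a p); first by exists a.
exists (- a); first exact: unit_normalN.
split; last by rewrite dotNl oppr_gt0 lt_neqAle ap.
by rewrite ha -scaleN1r -[X in hyperplane (_ *: _) X](mulr0 (-1)) hyperplaneZ// oppr_eq0 oner_eq0.
Qed.

Definition positive a := unit_normal a /\ 0 < dot a p.

Lemma positiveN a : unit_normal a -> positive a \/ positive (- a).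
Proof.
move=> ra; have ap : dot a p != 0.
  by apply/eqP => ap; apply: (p_chamber (unit_normal_linear_wall ra)).
have [apos|aneg] := ltP 0 (dot a p); [by left|right].
by split; [exact: unit_normalN|rewrite dotNl oppr_gt0 lt_neqAle ap].
Qed.

Lemma positive_seq : exists s : seq 'rV[R]_n, forall a, a \in s <-> positive a.
Proof.
have finP : finite_set positive by apply: sub_finite_set finR => a [].
by have /finite_seqP[s E] := finP; exists s => a; rewrite E.
Qed.

Lemma closed_chamberP x : face_le L x p <-> forall a, positive a -> 0 <= dot a x.
Proof.
split=> [h a [ra ap]|h b c Lbc].
  have := h _ _ (unit_normal_linear_wall ra); rewrite !subr0 => -[->//|].
  by rewrite (gtr0_sg ap) => /eqP; rewrite sgr_cp0 => /ltW.
have [-> [a ra [bE b0]]] := linear_wall_unit_normal Lbc; rewrite !subr0 bE !dotZl.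
have eb : 0 < enorm b by rewrite enorm_gt0.
have [ax|ax] := eqVneq (dot a x) 0; [by left; rewrite ax mulr0|right].
rewrite !sgrM; congr (_ * _).
have [pa|pa] := positiveN ra.
  by rewrite (gtr0_sg pa.2) gtr0_sg// lt_neqAle eq_sym ax h.
have := h _ pa; rewrite dotNl oppr_ge0 => ax'.
have := pa.2; rewrite dotNl oppr_gt0 => ap.
by rewrite (ltr0_sg ap) ltr0_sg// lt_neqAle ax.
Qed.

Definition simple a := positive a /\ S (hyperplane a 0).

Lemma positive_inj a b : positive a -> positive b ->
  hyperplane a 0 = hyperplane b 0 -> a = b.
Proof.
move=> [[a1 _] ap] [[b1 _] bp] /(hyperplane_inj a1 b1)[//|E].
by move: ap; rewrite E dotNl oppr_gt0 ltNge (ltW bp).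
Qed.

Lemma chamber_wall_simple h : S h -> exists2 a, simple a & h = hyperplane a 0.
Proof.
move=> /[dup] Sh [u [_ uh]].
have [Lh _] : [set k | L k /\ k u] h by rewrite uh.
by have [a ra [E ap]] := linear_wallP Lh; exists a => //; split; rewrite -?E.
Qed.

Lemma simple_panel a : simple a -> exists u, dot a u = 0 /\
  forall b, positive b -> b <> a -> 0 < dot b u.
Proof.
move=> [pa [u [up uh]]]; exists u.
have [_ au] : [set k | L k /\ k u] (hyperplane a 0) by rewrite uh.
split => // b pb ba; have := (closed_chamberP u).1 up _ pb.
rewrite le_eqVlt => /predU1P[bu|//]; exfalso; apply: ba.
have : [set k | L k /\ k u] (hyperplane b 0).
  by split; [exact: unit_normal_linear_wall pb.1|].
by rewrite uh => /(positive_inj pb pa).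
Qed.

(** If [dot a b] were positive, the reflected normal [r] would be positive at a point of the panel
    of [a] and negative at one of the panel of [b]. But a normal has constant weak sign on the
    closed chamber. *)
Lemma simple_obtuse a b : simple a -> simple b -> a <> b -> dot a b <= 0.
Proof.
move=> sa sb ab; rewrite leNgt; apply/negP => d0.
have [u [au hu]] := simple_panel sa; have [v [bv hv]] := simple_panel sb.
have bu := hu b sb.1 (fun E => ab (esym E)); have av := hv a sa.1 ab.
set r := b - (2 * dot a b) *: a.
have rr : unit_normal r by apply: unit_normal_reflection => //; [exact: sa.1.1|exact: sb.1.1].
have ru : 0 < dot r u by rewrite /r !dot_linear au; lra.
have rv : dot r v < 0 by rewrite /r !dot_linear bv; nra.
have closed x c : dot c x = 0 -> (forall b, positive b -> b <> c -> 0 < dot b x) ->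
    forall b, positive b -> 0 <= dot b x.
  by move=> cx h b' pb; have [->|/eqP/(h _ pb)/ltW//] := eqVneq b' c; rewrite cx.
have [pr|pr] := positiveN rr.
  by have := closed _ _ bv hv _ pr; rewrite leNgt rv.
by have := closed _ _ au hu _ pr; rewrite dotNl oppr_ge0 leNgt ru.
Qed.

(* A segment that leaves the chamber of [p] generically does so through a panel. *)
Lemma simple_closed_chamber x : (forall a, simple a -> 0 <= dot a x) ->
  face_le L x p.
Proof.
move=> hx; apply/closed_chamberP => b pb; rewrite leNgt; apply/negP => bx.
have [s hs] := positive_seq; have bp := pb.2.
(* This halves the value of [b]: at [x1] it is still negative, while all simple normals have become
   strictly positive. *)
pose tau := - dot b x / (2 * dot b p).
have tau0 : 0 < tau by rewrite divr_gt0// ?mulr_gt0// oppr_gt0.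
pose x1 := x + tau *: p.
have bx1 : dot b x1 < 0.
  rewrite /x1 dotDr dotZr /tau invfM mulrA mulfVK ?gt_eqF//; lra.
have ax1 a : simple a -> 0 < dot a x1.
  by move=> sa; rewrite /x1 dotDr dotZr ltr_wpDl ?hx// mulr_gt0// sa.1.2.
have [e e0 he] := seq_pos_bound (fun a => dot a x1) (fun=> 1) s.
have r0 : 0 < Num.min e (- dot b x1) by rewrite lt_min e0 oppr_gt0.
(* [par a a'] is nonzero at the end point exactly when the segment from [p] does not cross the walls
   of [a] and [a'] at the same time. *)
pose par a a' := dot a p *: a' - dot a' p *: a.
pose bad := [seq q <- [seq (par a a', 0 : R) | a <- s, a' <- s] | q.1 != 0].
have [q|x2 [d d0 hx2]] := generic_point (s := bad) x1 r0.
  by rewrite mem_filter => /andP[].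
have [] := hx2 x2; first by rewrite subrr enorm0.
rewrite lt_min => /andP[x2e x2b] gen.
have near a : unit_normal a -> `|dot a x2 - dot a x1| <= enorm (x2 - x1).
  move=> [a1 _]; rewrite -dotNr -dotDr; apply: le_trans (norm_dot_le _ _) _.
  by rewrite a1 mul1r.
have bx2 : dot b x2 < 0.
  by have := near b pb.1; rewrite ler_norml => /andP[_]; lra.
have ax2 a : simple a -> 0 < dot a x2.
  move=> sa; have := he a ((hs a).2 sa.1) (ax1 a sa); rewrite normr1 mulr1.
  by have := near a sa.1.1; rewrite ler_norml => /andP[]; lra.
pose s' := [seq a <- s | dot a x2 < 0].
(* The time at which the segment from [p] to [x2] crosses the wall of [a]. The first wall crossed is
   crossed alone, at [v], so [v] is in a panel and [a0] is simple although negative at [x2]. *)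
pose f a := dot a p / (dot a p - dot a x2).
have bs' : b \in s' by rewrite mem_filter bx2; apply/hs.
have [a0 a0s' min0] := seq_argmin f bs'.
have [a0x2 a0s] : dot a0 x2 < 0 /\ a0 \in s by move: a0s'; rewrite mem_filter => /andP.
have pa0 : positive a0 by apply/hs.
have a0p := pa0.2.
have D0 : 0 < dot a0 p - dot a0 x2 by lra.
pose v := p + f a0 *: (x2 - p).
have vE a : dot a v = (dot a0 p * dot a x2 - dot a0 x2 * dot a p) / (dot a0 p - dot a0 x2).
  by rewrite /v !dot_linear /f; field; rewrite gt_eqF.
have a0v : dot a0 v = 0 by rewrite vE [X in X - _]mulrC subrr mul0r.
have av a : positive a -> a <> a0 -> 0 < dot a v.
  move=> pa aa0; have ap := pa.2; rewrite vE divr_gt0//.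
  have [x20|x20] := leP 0 (dot a x2); first by nra.
  have as' : a \in s' by rewrite mem_filter x20; apply/hs.
  have := min0 _ as'; rewrite /f ler_pdivrMr// mulrAC ler_pdivlMr; last lra.
  move=> hle; rewrite lt_neqAle; apply/andP; split; last nra.
  have [par0|par0] := eqVneq (par a0 a) 0.
    exfalso; apply: aa0; have [a1 _] := pa.1; have [a01 _] := pa0.1.
    have aE : a = (dot a p / dot a0 p) *: a0.
      have nz : dot a0 p != 0 by rewrite gt_eqF.
      apply: (scalerI nz).
      by rewrite scalerA mulrC (mulfVK nz); apply/eqP; rewrite -subr_eq0 -[X in X == _]/(par a0 a) par0.
    have k1 : dot a p / dot a0 p = 1.
      by have := congr1 (@enorm R n) aE; rewrite enormZ a1 a01 mulr1 gtr0_norm ?divr_gt0.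
    by rewrite aE k1 scale1r.
  have /gen : (par a0 a, 0) \in bad.
    rewrite mem_filter par0/=; apply/allpairsP; exists (a0, a) => /=.
    by split => //; apply/hs.
  by rewrite /= /par !dot_linear eq_sym; apply: contraNneq => h; rewrite (mulrC (dot a p)) -h.
have vp : face_le L v p.
  apply/closed_chamberP => a pa; have [->|/eqP aa0] := eqVneq a a0; first by rewrite a0v.
  exact/ltW/av.
have sa0 : simple a0.
  split => //; exists v; split => //; apply/seteqP; split => [k [Lk kv]|k ->]; last first.
    by split; [exact: unit_normal_linear_wall pa0.1|].
  have [a ra [E ap]] := linear_wallP Lk; rewrite E in kv *.
  have [->//|/eqP aa0] := eqVneq a a0.
  by have := av a (conj ra ap) aa0; rewrite (kv : dot a v = 0) ltxx.
by have := ax2 _ sa0; rewrite ltNge (ltW a0x2).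
Qed.

(** Gram-Schmidt: [q'] and [a'] are the components of [q] and [a] orthogonal to [s], and [k] removes
    from [q'] its part along [a']. If [a] depends on [s] then [a'] is 0 and its product with
    anything vanishes. *)
Lemma projection (s : seq 'rV[R]_n) q : uniq s -> exists c : 'rV[R]_n -> R,
  forall a, a \in s -> dot a (q - \sum_(b <- s) c b *: b) = 0.
Proof.
elim: s q => [|a s IH] q /=; first by exists (fun=> 0).
move=> /andP[nas us]; have [cq hq] := IH q us; have [ca ha] := IH a us.
set q' := q - _ in hq; set a' := a - _ in ha.
pose k := dot a' q' / dot a' a'.
exists (fun b => if b == a then k else cq b - k * ca b).
have -> : q - \sum_(b <- a :: s) (if b == a then k else cq b - k * ca b) *: b = q' - k *: a'.
  rewrite big_cons eqxx.
  have -> : \sum_(b <- s) (if b == a then k else cq b - k * ca b) *: b =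
      \sum_(b <- s) cq b *: b - k *: \sum_(b <- s) ca b *: b.
    rewrite scaler_sumr -sumrB big_seq [RHS]big_seq; apply: eq_bigr => b bs.
    case: eqVneq => [ba|_]; first by rewrite -ba bs in nas.
    by rewrite scalerBl scalerA.
  rewrite /q' /a'; clearbody k; move: (\sum_(b <- s) _) (\sum_(b <- s) _) => U V.
  by apply/rowP => i; rewrite !mxE; ring.
have hs b : b \in s -> dot b (q' - k *: a') = 0.
  by move=> bs; rewrite dotDr dotNr dotZr hq// ha// mulr0 subrr.
move=> b; rewrite inE => /predU1P[->|/hs//].
have -> : a = a' + \sum_(b <- s) ca b *: b by rewrite subrK.
rewrite dotDl (_ : dot (\sum_(b <- s) ca b *: b) _ = 0); last first.
  rewrite dotC; elim: (s) hs => [|x t IHt] ht; first by rewrite big_nil dot0r.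
  rewrite big_cons dotDr dotZr dotC ht ?mem_head// mulr0 add0r IHt// => y yt.
  by apply: ht; rewrite inE yt orbT.
rewrite addr0 dotDr dotNr dotZr /k.
have [->|a'0] := eqVneq a' 0; first by rewrite !dot0l mulr0 subrr.
by rewrite mulfVK ?subrr// dotxx_eq0.
Qed.

Lemma dot_suml (s : seq 'rV[R]_n) (c : 'rV[R]_n -> R) x :
  dot (\sum_(b <- s) c b *: b) x = \sum_(b <- s) c b * dot b x.
Proof.
elim: s => [|a s IH]; first by rewrite !big_nil dot0l.
by rewrite !big_cons dotDl dotZl IH.
Qed.

(** Split the combination as [yp - ym] by the signs of the coefficients. Obtuseness gives
    [dot yp ym <= 0], hence [dot ym y <= 0]; but this is a sum of the nonnegative terms
    [cm a * dot a y], so every [cm a] is 0. *)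
Lemma obtuse_coefficients (s : seq 'rV[R]_n) (c : 'rV[R]_n -> R) :
  (forall a b, a \in s -> b \in s -> a <> b -> dot a b <= 0) ->
  (forall a, a \in s -> 0 < dot a (\sum_(b <- s) c b *: b)) ->
  forall a, a \in s -> 0 <= c a.
Proof.
move=> obt pos; set y := \sum_(b <- s) c b *: b.
pose cm b := Num.max (- c b) 0; pose cp b := Num.max (c b) 0.
have cE b : c b = cp b - cm b.
  by rewrite /cp /cm; case: leP => h; case: leP => k; lra.
have cm0 b : 0 <= cm b by rewrite le_max lexx orbT.
have cp0 b : 0 <= cp b by rewrite le_max lexx orbT.
have cc b : cp b * cm b = 0.
  by rewrite /cp /cm; case: leP => h; case: leP => k; nra.
pose yp := \sum_(b <- s) cp b *: b; pose ym := \sum_(b <- s) cm b *: b.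
have yE : y = yp - ym.
  by rewrite /y /yp /ym -sumrB; apply: eq_bigr => b _; rewrite cE scalerBl.
have le0 : dot yp ym <= 0.
  rewrite dot_suml big_seq; apply: sumr_le0 => a as_; rewrite dotC dot_suml mulr_sumr.
  rewrite big_seq; apply: sumr_le0 => b bs; rewrite mulrA.
  have [->|/eqP ba] := eqVneq b a; first by rewrite cc mul0r.
  by rewrite mulr_ge0_le0 ?mulr_ge0// obt.
have ge0 a : a \in s -> 0 <= cm a * dot a y.
  by move=> as_; rewrite mulr_ge0// ltW// pos.
have sum0 : \sum_(a <- s) cm a * dot a y = 0.
  apply/eqP; rewrite eq_le; apply/andP; split.
    rewrite -dot_suml -/ym yE dotDr dotNr (dotC ym yp).
    by have := dotxx_ge0 ym; lra.
  by rewrite big_seq; apply: sumr_ge0.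
move=> a as_; have : cm a * dot a y = 0.
  move/eqP: sum0; rewrite big_seq psumr_eq0 => [/allP/(_ a as_)|//].
  by rewrite as_ => /eqP.
move=> /eqP; rewrite mulf_eq0 (gt_eqF (pos a as_)) orbF => /eqP h.
by rewrite cE h subr0.
Qed.

Context (I : set (set 'rV[R]_n)) (I_proper : I `<` S).

(* [u] is the component of [p] orthogonal to the normals of [I]; as simple normals form obtuse
   angles, it stays in the closed chamber. *)
Lemma face_of_type : exists u, [/\ face_le L u p, u != 0 &
  I = [set h | S h /\ h u]].
Proof.
have IS : I `<=` S by case: I_proper.
have [s hs] := positive_seq.
pose s' := [seq a <- undup s | `[< I (hyperplane a 0) >]].
have s'P a : a \in s' <-> simple a /\ I (hyperplane a 0).
  rewrite mem_filter mem_undup; split=> [/andP[/asboolP Ia /hs pa]|[[pa _] Ia]].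
    by split => //; split => //; exact: IS.
  by apply/andP; split; [exact/asboolP|exact/hs].
have us' : uniq s' by rewrite filter_uniq// undup_uniq.
have [c hc] := projection p us'.
pose y := \sum_(b <- s') c b *: b; rewrite -/y in hc.
have c0 : forall a, a \in s' -> 0 <= c a.
  apply: obtuse_coefficients => [a b /s'P[sa _] /s'P[sb _]|a as_].
    exact: simple_obtuse.
  have /s'P[[[_ ap] _] _] := as_.
  by have := hc a as_; rewrite dotDr dotNr => /eqP; rewrite subr_eq0 => /eqP <-.
pose u := p - y.
have uI a : simple a -> I (hyperplane a 0) -> dot a u = 0.
  by move=> sa Ia; apply: hc; apply/s'P.
have unI a : simple a -> ~ I (hyperplane a 0) -> 0 < dot a u.
  move=> sa nIa; rewrite /u dotDr dotNr subr_gt0; apply: le_lt_trans sa.1.2.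
  rewrite dotC dot_suml big_seq; apply: sumr_le0 => b bs'.
  rewrite mulr_ge0_le0 ?c0//; have /s'P[sb Ib] := bs'.
  by apply: simple_obtuse => // E; apply: nIa; rewrite -E.
have [h Sh nIh] : exists2 h, S h & ~ I h.
  by have [_ /existsNP[h /not_implyP[]]] := I_proper; exists h.
exists u; split.
- apply: simple_closed_chamber => a sa.
  by have [/(uI _ sa)->//|/(unI _ sa)/ltW] := EM (I (hyperplane a 0)).
- have [a sa ha] := chamber_wall_simple Sh; rewrite ha in nIh.
  by apply/eqP => u0; have := unI a sa nIh; rewrite u0 dot0r ltxx.
- apply/seteqP; split => [k Ik|k [Sk ku]].
    split; first exact: IS.
    have [a sa E] := chamber_wall_simple (IS _ Ik); rewrite E in Ik *.
    exact: uI.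
  apply: contrapT => nIk; have [a sa E] := chamber_wall_simple Sk.
  rewrite E in ku nIk; have := unI a sa nIk.
  by rewrite (ku : dot a u = 0) ltxx.
Qed.

Lemma finite_type : finite_set I.
Proof.
have [s hs] := positive_seq.
apply: (@sub_finite_set _ _ [set` [seq hyperplane a 0 | a <- s]]); last exact: finite_seq.
move=> h /(proj1 I_proper)/chamber_wall_simple[a sa ->] /=.
by apply: map_f; apply/hs; exact: sa.1.
Qed.

(** For small [e] both [T + e *: v] and [T - e *: v] satisfy the simple inequalities, so they are in
    the closed chamber. A positive normal vanishing at [T] is then nonnegative on [v] and on
    [- v]. *)
Lemma type_span T v : face_le L T p -> I = [set h | S h /\ h T] ->
  (forall a, I (hyperplane a 0) -> dot a v = 0) ->
  forall b, unit_normal b -> dot b T = 0 -> dot b v = 0.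
Proof.
move=> Tp IE vI; have Tpos := (closed_chamberP T).1 Tp.
have [s hs] := positive_seq.
have [e e0 he] := seq_pos_bound (fun a => dot a T) (fun a => dot a v) s.
have near k a : `|k| <= e -> simple a -> 0 <= dot a (T + k *: v).
  move=> ke sa; rewrite dotDr dotZr; have := Tpos a sa.1; rewrite le_eqVlt => /predU1P[aT|aT].
    by rewrite -aT vI ?mulr0 ?addr0// IE; split; [exact: sa.2|].
  have := he a ((hs a).2 sa.1) aT; have : `|k| * `|dot a v| <= e * `|dot a v| by rewrite ler_wpM2r.
  rewrite -normrM; have := ler_norm (- (k * dot a v)); rewrite normrN; lra.
have pos k b : `|k| <= e -> positive b -> 0 <= dot b (T + k *: v).
  move=> ke; apply: (closed_chamberP _).1; apply: simple_closed_chamber => a; exact: near.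
have main b : positive b -> dot b T = 0 -> dot b v = 0.
  move=> pb bT; have := pos e b; have := pos (- e) b.
  rewrite normrN gtr0_norm// lexx => /(_ isT pb) + /(_ isT pb).
  rewrite !dotDr !dotZr bT !add0r => h1 h2.
  by apply/eqP; rewrite eq_le; apply/andP; split; nra.
move=> b rb bT; have [pb|pb] := positiveN rb; first exact: main.
by apply/eqP; rewrite -oppr_eq0 -dotNl main// dotNl bT oppr0.
Qed.

End SimpleRoots.

(** * Axes *)

Section PeriodicChart.
Context {R : realType} {n : nat} {H : set (set 'rV[R]_n)}.
Context (HW : euclidean_walls H).
Context {X : metricType R} {A : set ('rV[R]_n -> X)}.
Context (BA : building_atlas H A) (CA : complete_atlas H A).
Context (LF : locally_finite H A).
Context {G : groupType} {act : G -> X -> X}.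
Context (act_aut : acts_by_automorphisms H A act) (act_cocompact : cocompact act).
Implicit Types (x y z u v a b : 'rV[R]_n).
Local Notation unit_normal := (unit_normal (H := H)).
Local Notation wall_isometry := (wall_isometry (H := H)).

(** One isolated wall per direction is enough: a translation that permutes the walls and shifts this
    one by less than the gap must fix it. *)
Lemma parallel_walls_gap a : unit_normal a -> exists2 e : R, 0 < e &
  exists2 c : R, H (hyperplane a c) &
    forall c' : R, H (hyperplane a c') -> `|c' - c| < e -> c' = c.
Proof.
move=> /[dup] ra [a1 [c Hc]]; have aa := unit_normal_dot ra.
have [e e0 he] := face_le_near HW (c *: a); exists e => //; exists c => // c' Hc' cc'.
have /he/(_ _ _ Hc') : enorm (c' *: a - c *: a) < e.
  by rewrite -scalerBl enormZ a1 mulr1.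
rewrite !dotZr aa !mulr1 subrr sgr0 => -[//|/eqP].
by rewrite sgr_eq0 subr_eq0 => /eqP.
Qed.

Lemma linear_close (Q : 'M[R]_n) (e : R) a :
  (forall i, enorm (delta_mx 0 i *m Q - delta_mx 0 i) <= e) -> enorm a = 1 ->
  enorm (a *m Q - a) <= n%:R * e.
Proof.
move=> h a1.
have -> : a *m Q - a = \sum_i a 0 i *: (delta_mx 0 i *m Q - delta_mx 0 i).
  rewrite {1 2}[a]row_sum_delta mulmx_suml -sumrB; apply: eq_bigr => i _.
  by rewrite -scalemxAl scalerBr.
apply: (@le_trans _ _ (\sum_(i < n) e)); last by rewrite sumr_const card_ord mulr_natl.
elim/big_ind2 : _ => [|x1 y1 x2 y2 h1 h2|i _].
- by rewrite enorm0.
- by apply: le_trans (enormD _ _) _; apply: lerD.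
- rewrite enormZ -[leRHS]mul1r ler_pM ?enorm_ge0// -a1; exact: enorm_coord.
Qed.

(* Unit normals are separated, so a linear part close to the identity fixes all of them. *)
Lemma wall_isometry_translation (eta : R) psi (Q : 'M[R]_n) b :
  (forall a a', unit_normal a -> unit_normal a' -> enorm (a - a') < eta -> a = a') ->
  Q *m Q^T = 1%:M -> (forall x, psi x = x *m Q + b) ->
  (forall a (c : R), H (hyperplane (a *m Q) (c + dot (a *m Q) b)) <-> H (hyperplane a c)) ->
  (forall a, unit_normal a -> enorm (a *m Q - a) < eta) ->
  (forall a, unit_normal a -> a *m Q = a) /\ forall x, psi x = x + b.
Proof.
move=> sep QQ E HQ close.
have aQ a : unit_normal a -> a *m Q = a.
  move=> ra; apply: sep => //; last exact: close.
  have [a1 [c Hc]] := ra; split; first by rewrite orthogonal_enorm.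
  by exists (c + dot (a *m Q) b); rewrite HQ.
split => // x; rewrite E; congr (_ + _); apply/eqP; rewrite -subr_eq0; apply/eqP.
apply: (walls_essential HW) => a c Hac.
have [a' ra' ->] := wall_unit_normal HW Hac; rewrite dotZl.
by rewrite dotDr dotNr -{1}(aQ _ ra') orthogonal_dot// subrr mulr0.
Qed.

(* Among the charts [f (_ + i *: u)], two are close to being translates under [G]; by
   discreteness the defect is a translation [T], close to a multiple of [u]. If [dot a u = 0]
   then [T] shifts the walls orthogonal to [a] by less than their gap, so [dot a T = 0]. *)
Lemma periodic_chart u : exists g f (c T : 'rV[R]_n), [/\ A f, in_chamber H c,
  forall z, face H c z -> act g (f z) = f (z + T),
  wall_isometry (fun z => z + T) &
  forall a, unit_normal a -> Num.sg (dot a T) = Num.sg (dot a u)].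
Proof.
have [M HM] := walls_through_bounded HW BA CA LF act_aut act_cocompact.
have [eta eta0 sep] := unit_normals_separated HW HM.
have /finite_seqP[s Es] := finite_unit_normals HW HM.
have sP a : unit_normal a -> a \in s by move=> ra; have : [set` s] a by rewrite -Es.
have /choice[gap gapP] : forall a, exists e : R, unit_normal a -> 0 < e /\
    exists2 c : R, H (hyperplane a c) & forall c' : R, H (hyperplane a c') -> `|c' - c| < e -> c' = c.
  move=> a; have [ra|nra] := EM (unit_normal a); last by exists 0.
  by have [e e0 he] := parallel_walls_gap ra; exists e.
have [e1 e10 he1] := seq_pos_bound (fun a => `|dot a u|) (fun=> 1) s.
have [e2 e20 he2] := seq_pos_bound gap (fun=> 1) s.
(* The first bound makes the linear part fix all normals: basis vectors move by at most [2 * e],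
   hence unit normals by at most [2 * n * e < eta]. The bound [e1] preserves nonzero signs and [e2]
   stays below the gaps between walls. *)
pose e := Num.min (eta / (2 * n%:R + 1)) (Num.min e1 e2).
have den0 : 0 < 2 * n%:R + 1 :> R by rewrite ltr_wpDl ?mulr_ge0.
have e0 : 0 < e by rewrite !lt_min e10 e20 divr_gt0.
have ee : e * (2 * n%:R + 1) <= eta by rewrite -ler_pdivlMr// ge_min lexx.
have ee1 : e <= e1 by rewrite !ge_min lexx orbT.
have ee2 : e <= e2 by rewrite !ge_min lexx !orbT.
have [f Af] := chart_exists BA.
pose x (i : nat) := i%:R *: u.
have /choice[c hc] : forall i, exists c : 'rV[R]_n, in_chamber H c /\ face_le H (x i) c.
  by move=> i; have [c [_ Hc xc]] := chamber_near HW (x i) ltr01; exists c.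
have [d [ch [w0 [Ad _ infJ]]]] := chart_recurrence HW BA CA LF act_aut act_cocompact
  (fun=> Af) (fun i => (hc i).1) (fun i => (hc i).2).
set J := [set i | _] in infJ.
have /choice[gp hgp] : forall i, exists gp : G * ('rV[R]_n -> 'rV[R]_n), J i ->
    [/\ wall_isometry gp.2, forall z, face H (c i) z -> act gp.1 (f z) = d (gp.2 z),
        face H ch (gp.2 (c i)) & enorm (gp.2 (x i) - w0) < 1].
  move=> i; have [[g [phi h]]|nJ] := EM (J i); first by exists (g, phi).
  by exists (1%g, id).
(* The origin and the basis vectors form an affine frame, so colouring its images controls the
   linear part as well as the translation. The images lie within 2 of [w0]. *)
pose pt (o : option 'I_n) : 'rV[R]_n := if o is Some i then delta_mx 0 i else 0.
have [N [col hcol]] := bounded_coloring (n := n) 2 e0.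
pose color i := [ffun o : option 'I_n => col ((gp i).2 (x i + pt o) - w0)].
have [t _ inft] := infinite_pigeonhole (f := color) (@finite_finset _ setT) infJ (fun _ _ => Logic.I).
have [j [k [Jj Jk jk ejk]]] : exists j k, [/\ J j, J k, (j < k)%N & color j = color k].
  have [j [k [[Jj cj] [Jk ck] jk]]] := infinite_two inft.
  case: (ltngtP j k) => // h; [exists j, k|exists k, j]; split => //; first by rewrite cj.
  by rewrite ck.
have [ij aj fj wj] := hgp j Jj; have [ik ak fk wk] := hgp k Jk.
have close y o : y = pt o -> enorm ((gp j).2 (x j + y) - (gp k).2 (x k + y)) < e.
  move=> ->; have bnd i : J i -> enorm ((gp i).2 (x i + pt o) - w0) <= 2.
    move=> /hgp[iso _ _ h]; apply: le_trans (enorm_tri ((gp i).2 (x i)) _ _) _.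
    rewrite (wall_isometry_iso iso) [x i + _ - _]addrC addKr.
    have : enorm (pt o) <= 1 by case: (o) => [i'|] /=; rewrite ?enorm_delta ?enorm0.
    by lra.
  have := hcol _ _ (bnd j Jj) (bnd k Jk).
  rewrite opprB addrA subrK; apply.
  by have := congr1 (fun f : {ffun option 'I_n -> {ffun 'I_n -> 'I_N.+1}} => f o) ejk;
    rewrite !ffunE.
move: (gp j) (gp k) ij aj fj ik ak fk close {ejk} => [gj pj] [gk pk] /= ij aj fj ik ak fk close.
(* [pj] and [pk] carry the two chambers to the same chamber of [d], so [q \o pj] is the action of
   [gk^-1 * gj] on the chamber of [c j], read in the chart [f]. *)
have [q [iq Kq Kq']] := wall_isometry_inv ik.
have ipsi : wall_isometry (q \o pj) := wall_isometry_comp iq ij.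
pose psi y := q (pj y).
have clpsi y o : y = pt o -> enorm (psi (x j + y) - (x k + y)) < e.
  move=> yo; rewrite -(wall_isometry_iso ik) /psi Kq'; exact: close yo.
have [Q [b [QQ E HQ]]] := ipsi.
have Qclose i : enorm (delta_mx 0 i *m Q - delta_mx 0 i) <= 2 * e.
  have -> : delta_mx 0 i *m Q - delta_mx 0 i = (psi (x j + delta_mx 0 i) - (x k + delta_mx 0 i)) -
      (psi (x j + 0) - (x k + 0)).
    rewrite /psi -[q (pj _)]/((q \o pj) _) -[q (pj (x j + 0))]/((q \o pj) _) !E.
    by rewrite !mulmxDl mul0mx; apply/rowP => i'; rewrite !mxE; ring.
  apply: le_trans (enormD _ _) _; rewrite enormN.
  have := clpsi _ (Some i) erefl; have := clpsi 0 None erefl; lra.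
have [Qid Etr] : (forall a, unit_normal a -> a *m Q = a) /\ forall x, (q \o pj) x = x + b.
  apply: (wall_isometry_translation sep QQ E HQ) => a [a1 _].
  apply: le_lt_trans (linear_close Qclose a1) _; apply: lt_le_trans ee.
  rewrite (_ : e * _ = n%:R * (2 * e) + e) ?ltrDl//; ring.
have bclose : enorm (b - (k - j)%:R *: u) < e.
  have := clpsi 0 None erefl; rewrite /psi -[q (pj _)]/((q \o pj) _) Etr !addr0 /x.
  congr (_ < _); congr enorm; rewrite natrB ?(ltnW jk)//.
  by apply/rowP => i; rewrite !mxE; ring.
exists (gk^-1 * gj)%g, f, (c j), b; split => //; first exact: (hc j).1.
- move=> z cz; rewrite (act_mul act_aut) aj//.
  have zE : pk (z + b) = pj z by rewrite -Etr /= Kq'.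
  have ckz : face H (c k) (z + b).
    rewrite -(wall_isometry_face _ _ ik) zE.
    apply: face_trans (face_sym fk) _; apply: face_trans fj _.
    by rewrite wall_isometry_face.
  by rewrite -zE -ak// (actK act_aut).
- by rewrite (_ : (fun z => z + b) = q \o pj)//; apply/funext => z; rewrite Etr.
- move=> a ra; have /sP as_ := ra; have [a1 _] := ra.
  have ab : `|dot a b - (k - j)%:R * dot a u| < e.
    rewrite -dotZr -dotNr -dotDr; apply: le_lt_trans (norm_dot_le _ _) _.
    by rewrite a1 mul1r.
  have [au|au] := eqVneq (dot a u) 0.
    suff -> : dot a b = 0 by rewrite au.
    have [g0 [c0 Hc0 hc0]] := gapP a ra.
    have Hc1 : H (hyperplane a (c0 + dot a b)).
      by have := (HQ a c0).2 Hc0; rewrite Qid.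
    apply: (addrI c0); rewrite addr0; apply: hc0 Hc1 _.
    rewrite addrC addKr; move: ab; rewrite au mulr0 subr0 => /lt_le_trans; apply.
    by apply: le_trans ee2 _; have := he2 a as_ g0; rewrite normr1 mulr1.
  have := he1 a as_; rewrite normr_gt0 normr1 mulr1 => /(_ au) eau.
  have m1 : 1 <= (k - j)%:R :> R by rewrite ler1n subn_gt0.
  move: ab; rewrite ltr_norml => /andP[ab1 ab2].
  have [u0|u0|u0] := ltgtP (dot a u) 0; last by rewrite u0 eqxx in au.
    by rewrite (ltr0_sg u0) ltr0_sg//; rewrite ltr0_norm// in eau; nra.
  by rewrite (gtr0_sg u0) gtr0_sg//; rewrite gtr0_norm// in eau; nra.
Qed.

End PeriodicChart.

(** * Limits of charts that share a chamber *)

Section ChartLimits.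
Context {R : realType} {n : nat} {H : set (set 'rV[R]_n)}.
Context (HW : euclidean_walls H).
Context {X : metricType R} {A : set ('rV[R]_n -> X)}.
Context (BA : building_atlas H A) (CA : complete_atlas H A).
Context (LF : locally_finite H A).
Implicit Types (x y z u v a b : 'rV[R]_n).
Implicit Types (f k F : 'rV[R]_n -> X).

Lemma finite_factor (S T1 T2 : Type) (D : set S) (a : S -> T1) (b : S -> T2) :
  (forall i j, D i -> D j -> a i = a j -> b i = b j) ->
  finite_set (a @` D) -> finite_set (b @` D).
Proof.
move=> ab fin; have [[i0 Di0]|nD] := EM (exists i, D i); last first.
  have -> : b @` D = set0; last exact: finite_set0.
  by apply/seteqP; split => [x [i Di _]|x []]; apply: nD; exists i.
have /choice[h hP] : forall t, exists s, (exists2 i, D i & a i = t) -> exists2 i, D i & a i = t /\ b i = s.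
  move=> t; have [[i Di E]|nt] := EM (exists2 i, D i & a i = t); last by exists (b i0) => /nt.
  by exists (b i) => _; exists i.
apply: (@sub_finite_set _ _ (h @` (a @` D))); last exact: finite_image.
move=> _ [i Di <-]; exists (a i); first by exists i.
have [|j Dj [Ea <-]] := hP (a i); first by exists i.
exact: ab.
Qed.

Context (f : 'rV[R]_n -> X) (c : 'rV[R]_n) (Af : A f) (Hc : in_chamber H c).

(** Prescribing a chart on one chamber removes the freedom of reparametrisation, so that values of
    different charts at the same point can be compared. *)
Definition charts_at := [set k | A k /\ forall z, face H c z -> k z = f z].

Lemma charts_at_agree_face k k' v : charts_at k -> charts_at k' -> k v = k' v ->
  forall z, face H v z -> k z = k' z.
Proof.
move=> [Ak Ek] [Ak' Ek']; apply: (chart_agree_face HW BA Ak Ak' Hc) => z cz.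
by rewrite Ek ?Ek'.
Qed.

Lemma charts_at_face k k' v : charts_at k -> charts_at k' ->
  k @` face H v = k' @` face H v -> k v = k' v.
Proof.
move=> [Ak Ek] [Ak' Ek'] E.
have [y vy ky] : (k' @` face H v) (k v) by rewrite -E; exists v.
by rewrite -ky -(retraction_unique HW BA Ak Ak' Hc Ek Ek' (esym ky)).
Qed.

(** Finiteness passes from a face to the faces above it by local finiteness, and to those below it
    because charts agreeing on a face agree on its closure. Near any point of the segment from [c]
    to [v] all faces are above the face of that point, so finiteness propagates along the
    segment. *)
Lemma charts_at_finite v : finite_set [set k v | k in charts_at].
Proof.
pose Fin x := finite_set [set k x | k in charts_at].
have up x y : face_le H x y -> Fin x -> Fin y.
  move=> xy fx.
  have fs : finite_set [set k @` face H x | k in charts_at].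
    apply: (finite_factor _ fx) => k k' hk hk' E.
    have agree := charts_at_agree_face hk hk' E.
    by apply/seteqP; split => _ [z xz <-]; exists z => //; rewrite agree.
  have ft : finite_set [set k @` face H y | k in charts_at].
    apply: (@sub_finite_set _ _ (\bigcup_(s in [set k @` face H x | k in charts_at])
        [set t | simplex_le H A s t])).
      move=> _ [k hk <-]; exists (k @` face H x); first by exists k.
      by exists k, x, y; split => //; exact: hk.1.
    by apply: bigcup_finite => // _ [k [Ak _] <-]; apply: LF; exists k, x.
  by apply: (finite_factor _ ft) => k k' hk hk'; apply: charts_at_face.
have down x y : face_le H x y -> Fin y -> Fin x.
  move=> xy; apply: finite_factor => k k' hk hk' E.
  apply: (agree_closure (chart_isometric BA hk.1) (chart_isometric BA hk'.1) xy).
  exact: charts_at_agree_face.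
suff : Fin (c + 1 *: (v - c)) by rewrite scale1r addrC subrK.
apply: (clopen_line (S := fun t => Fin (c + t *: (v - c)))) => [|t].
  rewrite scale0r addr0; apply: (@sub_finite_set _ _ [set f c]); last exact: finite_set1.
  by move=> _ [k [_ Ek] <-]; rewrite /= Ek.
have [d d0 hd] := face_le_near HW (c + t *: (v - c)).
exists (d / (enorm (v - c) + 1)); first by rewrite divr_gt0// ltr_wpDl ?enorm_ge0.
move=> s; rewrite ltr_pdivlMr ?ltr_wpDl ?enorm_ge0// => st.
have ts : face_le H (c + t *: (v - c)) (c + s *: (v - c)).
  apply: hd; rewrite opprD addrACA subrr add0r -scalerBl enormZ.
  by apply: le_lt_trans st; rewrite ler_wpM2l// lerDl.
by split; [exact: down|exact: up].
Qed.

Lemma ultra_finite (U : set_system nat) (T : choiceType) (h : nat -> T) :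
  UltraFilter U -> finite_set (range h) -> exists q, U [set N | h N = q].
Proof.
move=> uU /finite_seqP[s Es]; apply: contrapT => nU.
have notU q : U [set N | h N <> q].
  by have [Uq|//] := in_ultra_setVsetC [set N | h N = q] uU; case: nU; exists q.
have : U [set N | h N \notin s].
  elim: (s) => [|q t IH]; first by apply: filterE.
  apply: filterS (filterI (notU q) IH) => N [/eqP hq ht] /=.
  by rewrite inE negb_or hq.
move/filter_ex => [N /negP]; apply; have : [set` s] (h N) by rewrite -Es; exists N.
by [].
Qed.

(* Pointwise limit along an ultrafilter; local finiteness makes it eventually constant. *)
Lemma chart_limit (k : nat -> 'rV[R]_n -> X) : (forall N, charts_at (k N)) ->
  exists F, A F /\ forall v q N0, (forall N, (N0 <= N)%N -> k N v = q) -> F v = q.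
Proof.
move=> hk; have [U [uU nU]] := ultraFilterLemma (F := \oo) _.
have /choice[F FP] : forall v, exists q, U [set N | k N v = q].
  move=> v; apply: ultra_finite; apply: sub_finite_set (charts_at_finite v).
  by move=> _ [N _ <-]; exists (k N).
exists F; split; last first.
  move=> v q N0 h; have : U [set N | (N0 <= N)%N] by apply: nU; exists N0.
  by move=> /(filterI (FP v))/filter_ex[N [<- /h]].
apply: (complete_local HW BA CA) => u v.
have [N [Nu Nv]] := filter_ex (filterI (FP u) (FP v)).
exists (k N) => [|z]; first exact: (hk N).1.
have main x : k N x = F x -> face H x z -> F z = k N z.
  move=> Nx xz; have [M [Mz Mx]] := filter_ex (filterI (FP z) (FP x)).
  by rewrite -Mz; apply: (charts_at_agree_face (hk M) (hk N) _ xz); rewrite Mx Nx.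
by move=> [/(main _ Nu)|/(main _ Nv)].
Qed.

End ChartLimits.

(** * Orthonormal frames of orthogonal complements *)

Section Frames.
Context {R : realType} {n : nat}.
Implicit Types (a x : 'rV[R]_n) (s t : seq 'rV[R]_n).

Lemma orthogonal_vector s : (size s < n)%N ->
  exists x, enorm x = 1 /\ forall a, a \in s -> dot a x = 0.
Proof.
move=> sn; pose B : 'M[R]_(size s, n) := \matrix_i nth 0 s i.
have : kermx B^T != 0.
  rewrite kermx_eq0 /row_free; apply/negP => /eqP E.
  by have := rank_leq_col B^T; rewrite E leqNgt sn.
move=> /rowV0Pn[x /sub_kermxP xB x0].
have ex : 0 < enorm x by rewrite enorm_gt0.
exists ((enorm x)^-1 *: x); split.
  by rewrite enormZ gtr0_norm ?invr_gt0// mulVf// gt_eqF.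
move=> a as_; rewrite dotZr (_ : dot a x = 0) ?mulr0//.
have ia : (index a s < size s)%N by rewrite index_mem.
have : (x *m B^T) 0 (Ordinal ia) = 0 by rewrite xB mxE.
by rewrite mxE dotC => <-; apply: eq_bigr => j _; rewrite !mxE nth_index.
Qed.

Lemma orthonormal_frame s k : (k <= n - size s)%N ->
  exists B : 'M[R]_(k, n), B *m B^T = 1%:M /\
    forall a y, a \in s -> dot a (y *m B) = 0.
Proof.
move=> ks.
suff [t [st tt ts]] : exists t, [/\ size t = k,
    forall i j, (i < k)%N -> (j < k)%N -> dot (nth 0 t i) (nth 0 t j) = (i == j)%:R &
    forall a b, a \in s -> b \in t -> dot a b = 0].
  exists (\matrix_i nth 0 t i); split.
    apply/matrixP => i j; rewrite !mxE -[RHS](tt i j)// /dot.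
    by apply: eq_bigr => l _; rewrite !mxE.
  move=> a y as_; rewrite mulmx_sum_row.
  elim/big_ind : _ => [|u v hu hv|i _]; first by rewrite dot0r.
    by rewrite dotDr hu hv addr0.
  by rewrite dotZr rowK ts ?mulr0// mem_nth// st.
elim: k ks => [|k IH] ks; first by exists [::]; split.
have [t [st tt ts]] := IH (ltnW ks).
have [|x [x1 hx]] := @orthogonal_vector (s ++ t).
  by rewrite size_cat st -ltn_subRL.
have xx : dot x x = 1 by rewrite -sqr_enorm x1 expr1n.
exists (x :: t); split => [|i j ik jk|a b as_]; first by rewrite /= st.
- case: i j ik jk => [|i] [|j] //= ik jk; rewrite ?eqSS.
  + by rewrite dotC hx// mem_cat mem_nth ?orbT// st.
  + by rewrite hx// mem_cat mem_nth ?orbT// st.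
  + exact: tt.
- rewrite inE => /predU1P[->|]; last exact: ts.
  by rewrite hx// mem_cat as_.
Qed.

End Frames.

(** * The axes of the group element and a chart containing them *)

Section Axis.
Context {R : realType} {n : nat} {H : set (set 'rV[R]_n)}.
Context (HW : euclidean_walls H).
Context {X : metricType R} {A : set ('rV[R]_n -> X)}.
Context (BA : building_atlas H A) (CA : complete_atlas H A).
Context (LF : locally_finite H A).
Context {G : groupType} {act : G -> X -> X}.
Context (act_aut : acts_by_automorphisms H A act).
Implicit Types (x y z u v a b : 'rV[R]_n).
Local Notation unit_normal := (unit_normal (H := H)).
Local Notation wall_isometry := (wall_isometry (H := H)).
Local Notation twisted_chart := (twisted_chart (H := H) (A := A)).

Lemma iter_act g N (x : X) : iter N (act g) x = act (g ^+ N)%g x.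
Proof.
elim: N => [|N IH]; first by rewrite expg0 (act_one act_aut).
by rewrite expgS (act_mul act_aut) -IH.
Qed.

Lemma iter_twisted g N f : A f -> twisted_chart (iter N (act g) \o f).
Proof.
rewrite (_ : iter N (act g) = act (g ^+ N)%g); last exact/funext/iter_act.
exact: (act_twisted HW BA CA act_aut).
Qed.

Context (g0 : G) (f : 'rV[R]_n -> X) (c T : 'rV[R]_n).
Context (Af : A f) (Hc : in_chamber H c) (T0 : T != 0).
Context (fT : forall z, face H c z -> act g0 (f z) = f (z + T)).
Context (trT : wall_isometry (fun z => z + T)).
Local Notation g := (act g0).
Local Notation g' := (act g0^-1%g).

Let gK : cancel g g' := actK act_aut g0.
Let gVK : cancel g' g := actVK act_aut g0.
Let gi (x y : X) : mdist (g x) (g y) = mdist x y := act_isometric act_aut g0 x y.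
Let gi' (x y : X) : mdist (g' x) (g' y) = mdist x y := act_isometric act_aut g0^-1%g x y.

Lemma small_step z : face H c z -> exists2 e : R, 0 < e <= 1 & face H c (z + e *: T).
Proof.
move=> cz; have [d d0 hd] := chamber_open HW (chamber_face HW Hc cz).
have eT : 0 < enorm T by rewrite enorm_gt0.
exists (Num.min 1 (d / 2 / enorm T)); first by rewrite lt_min ltr01 !divr_gt0// ge_min lexx.
apply: face_trans cz _; apply: hd; rewrite addrC addKr enormZ gtr0_norm; last first.
  by rewrite lt_min ltr01 !divr_gt0.
apply: (@le_lt_trans _ _ (d / 2 / enorm T * enorm T)).
  by rewrite ler_wpM2r ?enorm_ge0// ge_min lexx orbT.
rewrite mulfVK ?gt_eqF//; lra.
Qed.

(** As the chamber is open, a short piece of the segment from [z] in direction [T] stays in it,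
    which is the germ condition of [iter_mdist]. Applying [g'] reduces the two-sided statement to
    the one-sided one. *)
Lemma orbit_mdist z i k : face H c z ->
  mdist (iter i g' (f z)) (iter k g (f z)) = (i + k)%:R * enorm T.
Proof.
move=> cz; elim: k i => [|k IH] i.
  have [e e01 cze] := small_step cz; rewrite addn0 /=.
  apply: (iter_mdist (g := g) (T := T) (e := e)) => //.
  - exact: (chart_CN HW BA Af).
  - exact: (chart_isometric BA Af).
  - exact: fT.
  - exact: fT.
by rewrite iterS -(gi' _ (g _)) gK -iterS IH addnS addSn.
Qed.

Lemma iter_isometric (h : X -> X) N (x y : X) :
  (forall x y : X, mdist (h x) (h y) = mdist x y) ->
  mdist (iter N h x) (iter N h y) = mdist x y.
Proof. by move=> hi; elim: N => //= N <-. Qed.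

(** Take a chart through the images of [f c] under the powers [- N.+1] and [N.+1] of [g]. It
    contains the images of the whole chamber, and the midpoints of opposite images are the points
    [f z] by [CN_unique]; so it can be normalised to agree with [f] on the chamber. *)
Lemma finite_axis_chart N : exists k, charts_at (H := H) (A := A) f c k /\
  forall z i, face H c z -> (i <= N.+1)%N ->
    k (z + i%:R *: T) = iter i g (f z) /\ k (z - i%:R *: T) = iter i g' (f z).
Proof.
set N1 := N.+1; pose m : R := N1%:R.
have m0 : 0 < m by rewrite ltr0n.
have m1 : 1 <= m by rewrite ler1n.
pose P := iter N1 g \o f; pose Q := iter N1 g' \o f.
have tP : twisted_chart P := iter_twisted g0 N1 Af.
have tQ : twisted_chart Q := iter_twisted g0^-1%g N1 Af.
have [k0 [Ak0 k0Q k0P]] := atlas_pair BA (Q c) (P c).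
have dQP z : face H c z -> mdist (Q z) (P z) = 2 * m * enorm T.
  by move=> cz; apply: etrans (orbit_mdist N1 N1 cz) _; rewrite natrD -/m; ring.
have half k x y z : A k -> k x = Q z -> k y = P z -> face H c z -> k (x + 2^-1 *: (y - x)) = f z.
  move=> Ak kx ky cz; symmetry.
  have xy : enorm (y - x) = 2 * m * enorm T.
    by rewrite enormC -(chart_isometric BA Ak) kx ky dQP.
  apply: (CN_unique (chart_CN HW BA Ak)); first by lra.
    by rewrite kx metric_sym (orbit_mdist N1 0 cz) addn0 xy -/m; lra.
  by rewrite ky (orbit_mdist 0 N1 cz) add0n xy -/m; lra.
have [a [b [ka kb]]] : exists a b, k0 a = Q c /\ k0 b = P c.
  by move: k0Q k0P => [a _ ka] [b _ kb]; exists a, b.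
have k0f : range k0 (f c).
  by exists (a + 2^-1 *: (b - a)) => //; apply: half.
have [k [Ak Ek kf]] := chart_normalize HW BA Af Ak0 k0f.
have tk := chart_twisted (H := H) Ak.
have kP : range k (P c) by rewrite Ek.
have kQ : range k (Q c) by rewrite Ek.
have [p [_ hp]] := twisted_change HW BA tP tk kP kP.
have [q [_ hq]] := twisted_change HW BA tQ tk kQ kQ.
have kinj := isometric_inj (chart_isometric BA Ak).
exists k; split => // z i cz iN.
have [e /andP[e0 e1] cze] := small_step cz.
have kpz : k (p z) = P z by apply: hp; left.
have kqz : k (q z) = Q z by apply: hq; left.
move: (p z) (q z) kpz kqz => pz qz kpz kqz.
have qp : enorm (pz - qz) = 2 * m * enorm T.
  by rewrite enormC -(chart_isometric BA Ak) kpz kqz dQP.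
have T1 := enorm_ge0 T.
(* The segment has length [2 * m * enorm T], and [s] measures the position from its midpoint in
   units of [enorm T]. *)
have param (x : X) (s : R) : - m <= s <= m -> mdist x (Q z) <= (m + s) * enorm T ->
    mdist x (P z) <= (m - s) * enorm T -> x = k (qz + ((m + s) / (2 * m)) *: (pz - qz)).
  move=> /andP[s1 s2] xQ xP; apply: (CN_unique (chart_CN HW BA Ak)).
  - by rewrite divr_ge0 ?ler_pdivrMr; lra.
  - by rewrite kqz qp mulrA (mulfVK (_ : 2 * m != 0))// gt_eqF//; lra.
  - rewrite kpz qp mulrA mulrBl mul1r (mulfVK (_ : 2 * m != 0)) ?gt_eqF//; last lra.
    by apply: le_trans xP _; lra.
have zE : z = qz + (m / (2 * m)) *: (pz - qz).
  apply: kinj; rewrite kf//; have := param (f z) 0; rewrite addr0; apply; first lra.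
    by rewrite metric_sym (orbit_mdist N1 0 cz) addn0.
  by rewrite (orbit_mdist 0 N1 cz) add0n subr0.
have zeE : z + e *: T = qz + ((m + e) / (2 * m)) *: (pz - qz).
  apply: kinj; rewrite kf//; apply: param; first lra.
    apply: le_trans (metric_triangle _ (f z) _) _.
    rewrite (chart_isometric BA Af) [z + _ - z]addrC addKr enormZ gtr0_norm//.
    by rewrite metric_sym (orbit_mdist N1 0 cz) addn0 -/m; lra.
  apply: le_trans (metric_triangle _ (g (f z)) _) _.
  rewrite fT// (chart_isometric BA Af) -fT//.
  have -> : z + e *: T - (z + T) = - ((1 - e) *: T).
    by apply/rowP => l; rewrite !mxE; ring.
  rewrite enormN enormZ ger0_norm; last lra.
  rewrite -[P z]/(g (iter N g (f z))) gi (orbit_mdist 0 N cz) add0n.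
  by rewrite /m -natr1; lra.
have m2 : 2 * m != 0 by rewrite gt_eqF//; lra.
(* The charts [k] and [f] agree at [z] and at [z + e *: T], and both points lie on the segment from
   [qz] to [pz]; their difference determines its direction. *)
have pq : pz - qz = (2 * m) *: T.
  have E1 : e *: T = (e / (2 * m)) *: (pz - qz).
    apply: (addrI z); rewrite zeE [X in _ = X + _]zE -addrA -scalerDl.
    by congr (_ + _ *: _); field; rewrite gt_eqF.
  have e2 : e / (2 * m) != 0 by rewrite mulf_neq0 ?invr_eq0// gt_eqF.
  apply: (scalerI e2); rewrite -E1 scalerA; congr (_ *: _); field.
  by rewrite gt_eqF.
have zq : z = qz + m *: T by rewrite {1}zE pq scalerA mulfVK.
have pos s : qz + ((m + s) / (2 * m)) *: (pz - qz) = z + s *: T.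
  by rewrite pq scalerA mulfVK// scalerDl addrA -zq.
have im : i%:R <= m by rewrite /m ler_nat.
have i0 : 0 <= i%:R :> R by [].
split.
  rewrite -pos; symmetry; apply: param; first lra.
    by rewrite metric_sym (orbit_mdist N1 i cz) natrD.
  rewrite /P /comp -{1}(subnKC iN) iterD iter_isometric//.
  by rewrite (orbit_mdist 0 _ cz) add0n natrB.
rewrite -scaleNr -pos; symmetry; apply: param; first lra.
  rewrite /Q /comp -{1}(subnKC iN) iterD iter_isometric//.
  by rewrite metric_sym (orbit_mdist _ 0 cz) addn0 natrB.
by rewrite (orbit_mdist i N1 cz) natrD opprK addrC.
Qed.

Lemma axis_chart : exists F, A F /\ forall z i, face H c z ->
  F (z + i%:R *: T) = iter i g (f z) /\ F (z - i%:R *: T) = iter i g' (f z).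
Proof.
have /choice[k hk] := finite_axis_chart.
have [F [AF FP]] := chart_limit HW BA CA LF Hc (fun N => (hk N).1).
exists F; split => // z i cz; split; apply: (FP _ _ i) => N iN.
  by have [] := (hk N).2 z i cz (leqW iN).
by have [] := (hk N).2 z i cz (leqW iN).
Qed.

(* The set [E] where [g \o F] and [F (_ + T)] agree is closed, convex and a union of faces. It
   contains the line [c + R T], and if [v] lies in every wall direction containing [T], then a
   point [c + s v] of [E] pushed along [T] falls into an open chamber, which lies in [E]. *)
Lemma axis_direction F : A F -> (forall z i, face H c z ->
    F (z + i%:R *: T) = iter i g (f z) /\ F (z - i%:R *: T) = iter i g' (f z)) ->
  forall v, (forall b, unit_normal b -> dot b T = 0 -> dot b v = 0) ->
  forall t, g (F (c + v + t *: T)) = F (c + v + t *: T + T).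
Proof.
move=> AF FP.
pose E := [set z | g (F z) = F (z + T)].
have t1 : twisted_chart (g \o F) := act_twisted HW BA CA act_aut g0 AF.
have t2 : twisted_chart (F \o (fun z => z + T)) := twisted_comp (chart_twisted AF) trT.
have i1 := twisted_isometric BA t1; have i2 := twisted_isometric BA t2.
have Eclosed x : (forall e : R, 0 < e -> exists2 z, E z & enorm (z - x) <= e) -> E x.
  by move=> hx; apply: (agree_closed i1 i2 _ hx).
have Econvex x y s : E x -> E y -> 0 <= s <= 1 -> E (x + s *: (y - x)).
  move=> Ex Ey s01; have /andP[s0 s1] := s01.
  apply: (CN_unique (F := F \o (fun z => z + T)) (twisted_CN HW BA t2) s01).
  - rewrite /= -Ex -[mdist _ _]/(mdist ((g \o F) _) ((g \o F) _)) i1.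
    by rewrite addrC addKr enormZ ger0_norm.
  - rewrite /= -Ey -[mdist _ _]/(mdist ((g \o F) _) ((g \o F) _)) i1.
    have -> : x + s *: (y - x) - y = - ((1 - s) *: (y - x)).
      by apply/rowP => l; rewrite !mxE; ring.
    by rewrite enormN enormZ ger0_norm; lra.
have Ec z i : face H c z -> E (z + i%:R *: T) /\ E (z - i%:R *: T).
  move=> cz; have [h1 h2] := FP z i cz; split.
    rewrite /E /= h1 -addrA -[X in _ + (_ + X)]scale1r -scalerDl natr1.
    by have [-> _] := FP z i.+1 cz.
  rewrite /E /= h2; case: (i) => [|i'].
    by have [] := FP z 1%N cz; rewrite !scale1r scale0r subr0.
  rewrite iterS gVK -addrA -[X in _ + (_ + X)]scale1r -scaleNr -scalerDl.
  have -> : - i'.+1%:R + 1 = - i'%:R :> R by rewrite -natr1; ring.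
  by rewrite scaleNr; have [_ ->] := FP z i' cz.
have Eface z : E z -> forall y, face H z y -> E y.
  move=> Ez; apply: (twisted_agree_face HW BA t1 t2 Hc) => // y cy.
  by have [+ _] := Ec y 0%N cy; rewrite scale0r addr0.
have Eline t : E (c + t *: T).
  pose M := (Num.truncn `|t|).+1.
  have tM : `|t| < M%:R by exact: truncnS_gt.
  have M0 : 0 < M%:R :> R by rewrite ltr0n.
  have [EM1 EM2] := Ec c M (face_refl (H := H) c).
  have := Econvex _ _ ((M%:R + t) / (2 * M%:R)) EM2 EM1.
  have -> : c - M%:R *: T + (M%:R + t) / (2 * M%:R) *: (c + M%:R *: T - (c - M%:R *: T)) = c + t *: T.
    by apply/rowP => l; rewrite !mxE; field; rewrite gt_eqF.
  apply; move: tM; rewrite ltr_norml => /andP[tM1 tM2].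
  by rewrite divr_ge0 ?ler_pdivrMr; lra.
have Eshift z t : E z -> E (z + t *: T).
  move=> Ez; apply: Eclosed => e e0.
  pose m := enorm (c - z) / e + 1.
  have ez := enorm_ge0 (c - z).
  have m1 : 1 <= m by rewrite lerDr divr_ge0// ltW.
  have m0 : 0 < m by lra.
  exists (z + m^-1 *: (c + (m * t) *: T - z)).
    by apply: Econvex => //; rewrite invr_ge0 (ltW m0) invf_le1.
  have -> : z + m^-1 *: (c + (m * t) *: T - z) - (z + t *: T) = m^-1 *: (c - z).
    by apply/rowP => l; rewrite !mxE; field; rewrite gt_eqF.
  rewrite enormZ gtr0_norm ?invr_gt0// mulrC ler_pdivrMr// /m mulrDr mulr1.
  by rewrite mulrCA divff ?gt_eqF// mulr1; lra.
move=> v hv t; suff : E (c + v) by move/(Eshift _ t).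
rewrite -[v]scale1r; apply: (clopen_line (S := fun s => E (c + s *: v))) => [|s].
  by have := Eline 0; rewrite !scale0r.
have gs s1 s2 : (c + s1 *: v) - (c + s2 *: v) = (s1 - s2) *: v.
  by rewrite opprD addrACA subrr add0r scalerBl.
have v1 : 0 < enorm v + 1 by rewrite ltr_wpDl ?enorm_ge0.
have [Es|nEs] := EM (E (c + s *: v)); last first.
  have [e e0 he] : exists2 e : R, 0 < e & forall z, E z -> e < enorm (z - (c + s *: v)).
    apply: contrapT => h; apply: nEs; apply: Eclosed => e e0.
    apply: contrapT => h'; apply: h; exists e => // z Ez.
    by rewrite ltNge; apply/negP => ze; apply: h'; exists z.
  exists (e / (enorm v + 1)); first by rewrite divr_gt0.
  move=> s' ss'; split => // /he; rewrite gs enormZ ltNge; move/negP; case.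
  move: ss'; rewrite ltr_pdivlMr// => /ltW; apply: le_trans.
  by rewrite ler_wpM2l// lerDl.
set x := c + s *: v in Es *.
have [d d0 hd] := face_le_near HW x.
have eT : 0 < enorm T by rewrite enorm_gt0.
pose tau := d / 2 / enorm T; have tau0 : 0 < tau by rewrite !divr_gt0.
have xx : face_le H x (x + tau *: T).
  apply: hd; rewrite addrC addKr enormZ gtr0_norm// mulfVK ?gt_eqF//; lra.
(* A wall through this point contains [x] too, so its normal kills [T] and hence [v]; the wall would
   then pass through [c]. *)
have Hx : in_chamber H (x + tau *: T).
  move=> h Hh; have [a [k [_ Eh]]] := walls_hyperplane HW Hh; rewrite Eh in Hh *.
  rewrite /hyperplane/= => axT.
  have ax : dot a x = k.
    have [//|/eqP] := xx a k Hh; rewrite axT subrr sgr0 sgr_eq0 subr_eq0.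
    by move/eqP.
  have aT : dot a T = 0.
    move: axT; rewrite dotDr dotZr ax => /eqP; rewrite -subr_eq0 addrC addKr.
    by rewrite mulf_eq0 (gt_eqF tau0) => /eqP.
  have av : dot a v = 0.
    have [b rb aE] := wall_unit_normal HW Hh; have a0 := wall_normal_neq0 HW Hh.
    rewrite aE dotZl hv ?mulr0//; apply/eqP; move/eqP: aT.
    by rewrite {1}aE dotZl mulf_eq0 enorm_eq0 (negbTE a0).
  by apply: (Hc Hh); rewrite /hyperplane/= -ax /x dotDr dotZr av mulr0 addr0.
have [d' d'0 hd'] := chamber_open HW Hx.
exists (d' / (enorm v + 1)); first by rewrite divr_gt0.
move=> s' ss'; split => // _.
have -> : c + s' *: v = (c + s' *: v + tau *: T) + (- tau) *: T.
  by rewrite scaleNr addrK.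
apply: (Eshift _ (- tau)); apply: (Eface _ (Eshift x tau Es)); apply: hd'.
rewrite opprD addrACA subrr addr0 gs enormZ.
move: ss'; rewrite ltr_pdivlMr//; apply: le_lt_trans.
by rewrite ler_wpM2l// lerDl.
Qed.

(** The orbit of [f c] moves at speed exactly [enorm T], and the orbit of any other [x] stays at
    constant distance from it. So [g] cannot move [x] by less, as large powers of [g] show. *)
Lemma translation_length_axis : translation_length g = enorm T.
Proof.
have cc := face_refl (H := H) c.
have low (x : X) : enorm T <= mdist x (g x).
  have up N : mdist x (iter N g x) <= N%:R * mdist x (g x).
    elim: N => [|N IH]; first by rewrite mdistxx mul0r.
    apply: le_trans (metric_triangle _ (iter N g x) _) _.
    by rewrite iterSr iter_isometric// -natr1; lra.
  rewrite leNgt; apply/negP => lt.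
  pose D := mdist (f c) x; have D0 : 0 <= D := mdist_ge0 _ _.
  have main N : N%:R * (enorm T - mdist x (g x)) <= 2 * D.
    have := orbit_mdist 0 N cc; rewrite add0n /= => E.
    have := metric_triangle (f c) x (iter N g (f c)).
    have := metric_triangle x (iter N g x) (iter N g (f c)).
    rewrite iter_isometric// E -/D (metric_sym x (f c)) -/D.
    have := up N; lra.
  have gap : 0 < enorm T - mdist x (g x) by rewrite subr_gt0.
  have := main (Num.truncn (2 * D / (enorm T - mdist x (g x)))).+1.
  by apply/negP; rewrite -ltNge -ltr_pdivrMr// truncnS_gt.
have att : mdist (f c) (g (f c)) = enorm T.
  by have := orbit_mdist 0 1 cc; rewrite add0n mul1r.
apply/eqP; rewrite eq_le; apply/andP; split.
  rewrite -att; apply: ge_inf; last by exists (f c).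
  by exists (enorm T) => _ [x _ <-].
apply: lb_le_inf; first by exists (mdist (f c) (g (f c))); exists (f c).
by move=> _ [x _ <-].
Qed.

End Axis.

(** * Endpoints of the axis and the final assembly *)

Section Conclusion.
Context {R : realType} {n : nat} {H : set (set 'rV[R]_n)}.
Context (HW : euclidean_walls H).
Implicit Types (a v T : 'rV[R]_n).

Lemma linear_face_scale v (k : R) : 0 < k -> face (linear_walls H) v (k *: v).
Proof.
move=> k0 a c /(linear_wall_unit_normal HW)[-> _].
by rewrite !subr0 dotZr sgrM gtr0_sg// mul1r.
Qed.

Context {X : metricType R} {A : set ('rV[R]_n -> X)}.

Lemma ideal_face_line (F : 'rV[R]_n -> X) c v : v != 0 ->
  ideal_face H F v (endpoint (fun t => F (c + (t / enorm v) *: v))).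
Proof.
move=> v0; have ev : 0 < enorm v by rewrite enorm_gt0.
exists c, ((enorm v)^-1 *: v); split.
- by apply: linear_face_scale; rewrite invr_gt0.
- by rewrite enormZ gtr0_norm ?invr_gt0// mulVf// gt_eqF.
- by congr endpoint; apply/funext => t; rewrite scalerA.
Qed.

End Conclusion.

Theorem theorem1p1 (R : realType) (n : nat) (n_gt0 : (0 < n)%N)
    (H : set (set 'rV[R]_n)) (X : metricType R) (A : set ('rV[R]_n -> X))
    (X_building : euclidean_building H A)
    (X_thick : thick H A) (X_locally_finite : locally_finite H A)
    (p : 'rV[R]_n) (p_chamber : in_chamber (linear_walls H) p)
    (G : groupType) (act : G -> X -> X)
    (act_aut : acts_by_automorphisms H A act) (act_cocompact : cocompact act)
    (I : set (set 'rV[R]_n))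
    (I_proper : I `<` chamber_walls (linear_walls H) p) :
  exists g : G, strongly_regular_hyperbolic H A p I (act g).
Proof.
have [HW BA CA] := X_building.
have LF := X_locally_finite.
have [M HM] := walls_through_bounded HW BA CA LF act_aut act_cocompact.
have finN := finite_unit_normals HW HM.
have [u [up u0 IE]] := face_of_type HW finN p_chamber I_proper.
have [g [f [c [T [Af Hc fT trT sgT]]]]] := periodic_chart HW BA CA LF act_aut act_cocompact u.
(* Everything needed about the position of [T] comes from its signs on the unit normals: that it is
   nonzero, lies in the closed model chamber and has type [I]. *)
have sg0 a : unit_normal (H := H) a -> dot a T = 0 <-> dot a u = 0.
  move=> ra; split=> h; apply/eqP; rewrite -sgr_eq0; first by rewrite -sgT// h sgr0.
  by rewrite sgT// h sgr0.
have T0 : T != 0.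
  apply: contra_neq u0 => T0; apply: (walls_essential HW) => a k Hak.
  have [b rb ->] := wall_unit_normal HW Hak.
  by rewrite dotZl (sg0 b rb).1 ?mulr0// T0 dot0r.
have Tp : face_le (linear_walls H) T p.
  apply/(closed_chamberP HW p_chamber) => a pa.
  have := (closed_chamberP HW p_chamber u).1 up a pa.
  by rewrite -[0 <= dot a u]sgr_ge0 -sgT ?sgr_ge0//; exact: pa.1.
have ITE : I = [set h | chamber_walls (linear_walls H) p h /\ h T].
  rewrite IE; apply/seteqP; split => h [Sh hu]; split => //;
    have [a sa E] := chamber_wall_simple HW p_chamber Sh; rewrite E in hu *;
    by apply/(sg0 a sa.1.1).
have [F [AF FP]] := axis_chart HW BA CA LF act_aut Af Hc T0 fT.
have Fg := axis_direction HW BA CA act_aut Hc T0 trT AF FP.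
have tl := translation_length_axis HW BA act_aut Af Hc T0 fT.
have eT : 0 < enorm T by rewrite enorm_gt0.
have inMin v : (forall b, unit_normal (H := H) b -> dot b T = 0 -> dot b v = 0) ->
    min_set (act g) (F (c + v)).
  move=> hv; rewrite /min_set /= tl; have := Fg v hv 0; rewrite scale0r !addr0 => ->.
  by rewrite (chart_isometric BA AF) opprD addrA subrr sub0r enormN.
exists g; split; first split.
- split; first by rewrite tl.
  by exists (F (c + 0)); apply: inMin => b _ _; rewrite dot0r.
(* One normal per wall of [I], so that [size s] is the cardinality of [I]. The default 0 does not
   occur on [I], since its members are linear walls. *)
- pose normal (h : set 'rV[R]_n) := xget 0 [set a | h = hyperplane a 0].
  have normalE h : I h -> h = hyperplane (normal h) 0.
    rewrite ITE => -[Sh _]; have [a _ E] := chamber_wall_simple HW p_chamber Sh.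
    by rewrite /normal; case: xgetP => [b _ <-//|/(_ a)].
  pose s := [seq normal h | h <- finmap.enum_fset (fset_set I)].
  rewrite -(size_map normal) -/s.
  have [B [BB sB]] := orthonormal_frame (leqnn (n - size s)).
  exists (range (fun y => F (c + y *m B))); split.
    exists (fun y => F (c + y *m B)); split => // y y'.
    rewrite (chart_isometric BA AF) opprD addrACA subrr add0r -mulmxBl.
    by rewrite /enorm !dotE trmx_mul mulmxA -(mulmxA (y - y')) BB mulmx1.
  move=> _ [y _ <-]; apply: inMin.
  apply: (type_span HW finN p_chamber Tp ITE) => a Ia.
  have : hyperplane (normal (hyperplane a 0)) 0 (y *m B).
    apply: sB; apply: map_f.
    rewrite in_fset_set ?inE//; exact: (finite_type HW finN p_chamber I_proper).
  by rewrite -normalE.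
exists (fun t => F (c + (t / enorm T) *: T)), (ideal_face H F T), (ideal_face H F (- T)); split.
- split=> [t t'|t].
    rewrite (chart_isometric BA AF) opprD addrACA subrr add0r -scalerBl -mulrBl.
    by rewrite enormZ normrM normfV (gtr0_norm eT) mulfVK// gt_eqF.
  have := Fg 0 _ (t / enorm T); rewrite addr0 => ->; last by move=> b _ _; rewrite dot0r.
  by rewrite tl mulrDl divff ?gt_eqF// scalerDl scale1r addrA.
- by exists F, T.
- by left; exists F, T.
- exact: ideal_face_line.
- have := ideal_face_line HW F c (v := - T); rewrite oppr_eq0 => /(_ T0).
  congr (_ (endpoint _)); apply/funext => t.
  by rewrite enormN scalerN -scaleNr mulNr.
Qed.
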